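(* For each $n$, let $y\sim\mathrm N_n(\mu_0,\sigma_0^2I_n)$ with $\mu_0=\mu_{0,n}\in\mathbb R^n$ and $\sigma_0=\sigma_{0,n}>0$, where $\sigma_0^2>n^{-B}$ for some constant $B>0$. Let the prior make $\mu\in\mathbb R^n$ and $\sigma^2$ independent, where the prior of $\sigma^2$ (not depending on $n$) has a density $g$ on $(0,\infty)$ that is $L$-Lipschitz on $(0,\infty)$ and satisfies $\Pi\{\sigma^2>t\}=O(t^{-1})$ as $t\to\infty$. Let $\epsilon_n>0$ satisfy $\epsilon_n/\sigma_0\to0$ and $n\epsilon_n^2/\sigma_0^2\ge\log n$, and suppose $g(\sigma_0^2)\ge 2L\sigma_0\epsilon_n$. Suppose there exist sets $\mathcal M_n\subset\mathbb R^n$ and constants $\bar C>0$, $\bar D>0$, $\bar E>0$ such that for all $n$ $$\Pi\{\lVert\mu-\mu_0\rVert_2^2\le n\epsilon_n^2\}\ge e^{-\bar Cn\epsilon_n^2/\sigma_0^2},\quad N(\sqrt n\,\epsilon_n,\mathcal M_n,\lVert\cdot\rVert_2)\le e^{\bar Dn\epsilon_n^2/\sigma_0^2},\quad \Pi\{\mu\notin\mathcal M_n\}\le e^{-\bar En\epsilon_n^2/\sigma_0^2}.$$ Then, provided $\bar E$ is sufficiently large (relative to $\bar C$ and $B$), there exists a constant $M>0$ such that $$\mathbb E_{\mu_0,\sigma_0}\Pi\{(\mu,\sigma):d((\mu,\sigma),(\mu_0,\sigma_0))\ge M\epsilon_n\mid y\}\to0\quad(n\to\infty).$$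
   Context: The posterior $\Pi(\cdot\mid y)$ is computed under the likelihood $y\mid(\mu,\sigma)\sim\mathrm N_n(\mu,\sigma^2I_n)$; $\mathbb E_{\mu,\sigma}$ is the expectation under $\mathrm N_n(\mu,\sigma^2I_n)$. The metric $d$ on $\mathbb R^n\times(0,\infty)$ is $d^2((\mu_1,\sigma_1),(\mu_2,\sigma_2))=n^{-1}\lVert\mu_1-\mu_2\rVert_2^2+|\sigma_1-\sigma_2|^2$. $N(\epsilon,\mathcal E,\rho)$ denotes the $\epsilon$-covering number of $\mathcal E$ with respect to $\rho$. *)

(* Defs.v *)
From HB Require Import structures.
From mathcomp Require Import all_boot all_order all_algebra.
From mathcomp Require Import all_classical all_reals all_analysis.
Set Implicit Arguments.
Unset Strict Implicit.
Unset Printing Implicit Defensive.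
Import Order.TTheory GRing.Theory Num.Theory.
Import numFieldNormedType.Exports.
Local Open Scope classical_set_scope.
Local Open Scope ring_scope.

Section defs.
Context {R : realType}.

Definition sqdist (n : nat) (x y : n.-tuple R) : R :=
  \sum_(i < n) (tnth x i - tnth y i) ^+ 2.

(* covering number N(r, E, ||.||_2): least number of closed Euclidean balls
   of radius r (centres anywhere in R^n) covering E; +oo if none exists. *)
Definition covering_number (n : nat) (r : R) (E : set (n.-tuple R)) : \bar R :=
  ereal_inf [set ((size c)%:R)%:E | c in
    [set c : seq (n.-tuple R) |
       E `<=` [set x | exists2 z, z \in c & Num.sqrt (sqdist x z) <= r]]].

Definition lik (n : nat) (y mu : n.-tuple R) (sigma : R) : R :=
  \prod_(i < n) normal_pdf (tnth mu i) sigma (tnth y i).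

Definition dmet (n : nat) (mu1 : n.-tuple R) (s1 : R)
    (mu2 : n.-tuple R) (s2 : R) : R :=
  Num.sqrt (sqdist mu1 mu2 / n%:R + (s1 - s2) ^+ 2).

(* prior: mu ~ Pmu, independent of sigma^2 ~ density g on (0,oo) (w.r.t.
   Lebesgue measure); parametrised by (mu, sigma) with sigma = sqrt(sigma^2).
   Unnormalised posterior mass of A : (mu, sigma) -> Prop given y. *)
Definition post_num (n : nat) (Pmu : probability (n.-tuple R) R) (g : R -> R)
    (A : set (n.-tuple R * R)) (y : n.-tuple R) : \bar R :=
  (\int[Pmu]_mu \int[lebesgue_measure]_(s in `]0%R, +oo[%classic)
     ((\1_A (mu, Num.sqrt s)) * g s * lik y mu (Num.sqrt s))%:E)%E.

Definition posterior (n : nat) (Pmu : probability (n.-tuple R) R) (g : R -> R)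
    (A : set (n.-tuple R * R)) (y : n.-tuple R) : R :=
  fine (post_num Pmu g A y) / fine (post_num Pmu g setT y).

(* E_{m, s} f(y) for y ~ N_n(m, s^2 I_n), as iterated integrals against the
   (library) normal distributions of the independent coordinates. *)
Fixpoint gauss_expect (n : nat) : n.-tuple R -> R -> (n.-tuple R -> \bar R) -> \bar R :=
  match n return n.-tuple R -> R -> (n.-tuple R -> \bar R) -> \bar R with
  | 0 => fun _ _ f => f [tuple]
  | n'.+1 => fun m s f =>
      (\int[normal_prob (thead m) s]_x
         gauss_expect (behead_tuple m) s (fun t => f (cons_tuple x t)))%E
  end.

End defs.

(* Main.v *)
Require Import Defs.
From HB Require Import structures.
From mathcomp Require Import all_boot all_order all_algebra.
From mathcomp Require Import all_classical all_reals all_analysis.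
From mathcomp Require Import measurable_realfun ring lra.
Import Order.TTheory GRing.Theory Num.Theory.
Import numFieldNormedType.Exports.
Local Open Scope classical_set_scope.
Local Open Scope ring_scope.

(** The posterior mass of an alternative A is N_A / D, both masses taken relative
    to the true density.  By Cauchy-Schwarz 1 / D is at most Pi(B)^-2 times the
    prior integral over B of p_0 / p_theta, and the expectation of p_0 / p_theta
    is e^(3 n eps^2 / sig0^2) on the ball B charged by the prior; so
    D >= delta := Pi(B) e^(-4 n eps^2 / sig0^2) up to an error e^(-n eps^2 / sig0^2).
    For the numerator, min(1, x) <= v + x / v for every v > 0: an exponential v of a
    quadratic form in y acts as a smooth test, and both E_0 v and E_theta (1 / v)
    are explicit Gaussian integrals.  The alternative splits into
    mu outside the sieve (constant v), sigma too large and sigma too small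
    (v exponential in |y - mu0|^2), and mu far from mu0 (one linear exponential per
    centre of the covering of the sieve). *)

(** * Integration against densities and product Gaussian expectations *)

(** Write [X] for n eps^2 / sig0^2. If the ball has prior mass at least e^(-(Cbar + k) X), then
    delta^-1 is at most e^(K X) with K = Cbar + k + 4, and every piece of the alternative must be
    small enough to pay for this factor. This fixes the threshold K + 2 for Ebar and makes M^2 a
    multiple of K + Dbar + 1, the Dbar covering the number of centres. The split follows what each
    test tolerates. A displaced mean only enlarges |y - mu0|^2, so the test against large variances
    is uniform in mu. Against small variances the displacement could hide the deficit, so mu must be
    close to mu0 there. The linear test for the mean needs the variance below a multiple of sig0^2
    but no lower bound. Hence the case of a far mean comes after large variances are removed, and
    small variances are only treated near mu0. The reciprocal ratio p_0 / p_theta has a finite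
    expectation only if the variance of theta exceeds sig0^2 / 2, which is why the prior ball also
    restricts sigma^2 to a narrow interval around sig0^2. *)

Lemma ge0_le_integral_nomeas d (T : measurableType d) (R : realType)
    (mu : {measure set T -> \bar R}) (f1 f2 : T -> \bar R) :
  (forall x, 0 <= f1 x)%E -> (forall x, f1 x <= f2 x)%E ->
  (\int[mu]_x f1 x <= \int[mu]_x f2 x)%E.
Proof.
move=> f10 f12.
have f20 x : (0 <= f2 x)%E by exact: le_trans (f12 x).
rewrite !ge0_integralTE//; apply: le_ereal_sup => _ [h hf <-].
by exists h => // x; exact: le_trans (f12 x).
Qed.

Section density.
Context d (T : measurableType d) (R : realType).
Variables (mu nu : {measure set T -> \bar R}) (p : T -> R).
Hypotheses (p0 : forall x, 0 <= p x) (mp : measurable_fun setT p).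
Hypothesis nuE : forall A, measurable A -> nu A = (\int[mu]_(x in A) (p x)%:E)%E.

Import HBNNSimple.

Lemma ge0_integral_density (f : T -> \bar R) :
  measurable_fun setT f -> (forall x, 0 <= f x)%E ->
  (\int[nu]_x f x = \int[mu]_x (f x * (p x)%:E))%E.
Proof.
move=> mf f0; pose f_ := nnsfun_approx measurableT mf.
have f_f x : ((f_ n x)%:E @[n --> \oo] --> f x)%E by exact: cvg_nnsfun_approx.
have ndf x : {homo (fun n => (f_ n x)%:E) : m n / (m <= n)%N >-> (m <= n)%E}.
  by move=> m n mn; rewrite lee_fin; exact/lefP/nd_nnsfun_approx.
transitivity (limn (fun n => \int[nu]_x (f_ n x)%:E)%E).
  rewrite -monotone_convergence//.
  - by apply: eq_integral => x _; apply/esym/cvg_lim => //; exact: f_f.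
  - by move=> n; exact/measurable_EFinP/measurable_funP.
  - by move=> n x _; rewrite lee_fin.
transitivity (limn (fun n => \int[mu]_x ((f_ n x)%:E * (p x)%:E))%E); last first.
  rewrite -monotone_convergence//.
  - apply: eq_integral => x _; apply/cvg_lim => //.
    by apply: cvgeZr => //; exact: f_f.
  - move=> n; apply: emeasurable_funM; apply/measurable_EFinP => //.
  - by move=> n x _; rewrite mule_ge0// lee_fin.
  - by move=> x _ m n mn; rewrite lee_wpmul2r// ?lee_fin//; exact: ndf.
congr (limn _); apply/funext => n.
transitivity (\sum_(k \in range (f_ n)) (k%:E * nu (f_ n @^-1` [set k])))%E.
  by rewrite integralT_nnsfun sintegralE.
transitivity (\sum_(k \in range (f_ n))
   (\int[mu]_x (k * (\1_(f_ n @^-1` [set k]) x * p x))%:E)%E)%E.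
  apply: eq_fsbigr => k /[!inE] -[z _ fz].
  have mA : measurable (f_ n @^-1` [set k]) by exact: measurable_sfunP.
  rewrite nuE//.
  under [RHS]eq_integral do rewrite EFinM.
  rewrite ge0_integralZl//.
  - congr (_ * _)%E; rewrite [LHS]integral_mkcond; apply: eq_integral => x _.
    by rewrite patchE indicE; case: (x \in _); rewrite ?mul1r ?mul0r.
  - by apply/measurable_EFinP; apply: measurable_funM => //; exact: measurable_indic.
  - by move=> x _; rewrite lee_fin mulr_ge0.
  - by rewrite lee_fin -fz.
rewrite -ge0_integral_fsum//.
- apply: eq_integral => x _; rewrite fsumEFin//.
  rewrite -EFinM; congr EFin; rewrite [in RHS](fimfunE (f_ n)) mulr_fsuml.
  by apply: eq_fsbigr => k _; rewrite mulrA.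
- by move=> k; apply/measurable_EFinP; apply: measurable_funM => //;
    apply: measurable_funM => //; exact: measurable_indic.
- move=> k x _; rewrite mulrA; rewrite lee_fin mulr_ge0//; exact: nnfun_muleindic_ge0.
Qed.

End density.

Section gauss.
Context {R : realType}.
Local Notation TR := (measurableTypeR R).

(* Lebesgue measure lives on [measurableTypeR R]; it and [R] have convertible
   sigma-algebras but different displays, so canonical inference separates them. *)
Lemma measurable_fun_TR d (T : measurableType d) (f : T -> R) :
  measurable_fun setT (f : T -> TR) -> measurable_fun setT f.
Proof. by []. Qed.

Lemma gauss_expect_ge0 n (m : n.-tuple R) s (f : n.-tuple R -> \bar R) :
  (forall y, 0 <= f y)%E -> (0 <= gauss_expect m s f)%E.
Proof.
elim: n m f => [|n IH] m f f0 //=.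
by apply: integral_ge0 => x _; apply: IH => y.
Qed.

(** Valid without measurability because the integral of a nonnegative function is a supremum over
    the simple functions below it. This is the only way in which the posterior, a quotient of [fine]
    values, enters an expectation. *)
Lemma le_gauss_expect n (m : n.-tuple R) s (f1 f2 : n.-tuple R -> \bar R) :
  (forall y, 0 <= f1 y)%E -> (forall y, f1 y <= f2 y)%E ->
  (gauss_expect m s f1 <= gauss_expect m s f2)%E.
Proof.
elim: n m f1 f2 => [|n IH] m f1 f2 f0 f12 //=.
apply: ge0_le_integral_nomeas => x; first by apply: gauss_expect_ge0.
by apply: IH.
Qed.

(** Collects the iterated integrals into one probability on tuples, obtained by pushing the product
    of a coordinate law and the law of the tail through [cons_tuple]. Tonelli can then exchange it
    with the prior. *)
Lemma gauss_expectE n (m : n.-tuple R) s :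
  exists P : probability (n.-tuple R) R, forall f : n.-tuple R -> \bar R,
    measurable_fun setT f -> (forall y, 0 <= f y)%E ->
    gauss_expect m s f = (\int[P]_y f y)%E.
Proof.
elim: n m => [|n IH] m.
  exists (dirac ([tuple] : 0.-tuple R)) => f mf f0 /=.
  by rewrite integral_dirac// diracT mul1e.
have [P PE] := IH (behead_tuple m).
pose c (p : TR * n.-tuple R) : n.+1.-tuple R := cons_tuple p.1 p.2.
have mc : measurable_fun setT c.
  by apply: measurable_cons => //; apply: measurable_fun_TR.
pose cm := isMeasurableFun.Build _ _ _ _ _ mc.
pose C : {mfun (TR * n.-tuple R)%type >-> (n.+1.-tuple R)} := HB.pack c cm.
exists (distribution (normal_prob (thead m) s \x P)%E C) => f mf f0.
rewrite ge0_integral_pushforward//= preimage_setT fubini_tonelli1//; last first.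
  exact: measurableT_comp.
apply: eq_integral => x _.
rewrite PE//; apply: measurableT_comp => //.
by apply: measurable_cons => //.
Qed.

Lemma normal_prob_integral (m s : R) (f : R -> \bar R) :
  measurable_fun setT f -> (forall x, 0 <= f x)%E ->
  (\int[normal_prob m s]_x f x =
   \int[lebesgue_measure]_x (f x * (normal_pdf m s x)%:E))%E.
Proof.
move=> mf f0; apply: ge0_integral_density => //.
- by move=> x; exact: normal_pdf_ge0.
- exact: measurable_normal_pdf.
Qed.

(** The free constant [k] serves the induction: once the first coordinate is fixed at [x], its
    factor [phi ord0 x] is absorbed into the constant of the remaining product. *)
Lemma gauss_expect_prod_le n (m : n.-tuple R) s (k : R) (phi : 'I_n -> R -> R)
    (r : 'I_n -> R) :
  0 <= k -> (forall i x, 0 <= phi i x) ->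
  (forall i, measurable_fun setT (phi i)) ->
  (forall i, \int[normal_prob (tnth m i) s]_x (phi i x)%:E <= (r i)%:E)%E ->
  (gauss_expect m s (fun y => (k * \prod_(i < n) phi i (tnth y i))%:E) <=
   (k * \prod_(i < n) r i)%:E)%E.
Proof.
elim: n m k phi r => [|n IH] m k phi r k0 phi0 mphi phir.
  by rewrite /= !big_ord0.
have r0 i : 0 <= r i.
  by rewrite -lee_fin; apply: le_trans (phir i); apply: integral_ge0 => x _; rewrite lee_fin.
have bm i : tnth (behead_tuple m) i = tnth m (lift ord0 i).
  by rewrite [in RHS](tuple_eta m) tnthS.
rewrite /= !big_ord_recl.
apply: (@le_trans _ _ (\int[normal_prob (thead m) s]_x
   ((k * \prod_(i < n) r (lift ord0 i))%:E * (phi ord0 x)%:E)))%E.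
  apply: ge0_le_integral_nomeas => x.
    by apply: gauss_expect_ge0 => y; rewrite lee_fin mulr_ge0// prodr_ge0.
  rewrite -EFinM mulrAC.
  apply: le_trans (IH (behead_tuple m) (k * phi ord0 x)
    (fun i => phi (lift ord0 i)) (fun i => r (lift ord0 i)) _ _ _ _).
  - apply: le_gauss_expect => y; rewrite lee_fin.
      by rewrite mulr_ge0// prodr_ge0.
    rewrite big_ord_recl mulrA tnth0.
    by under eq_bigr do rewrite tnthS.
  - by rewrite mulr_ge0.
  - by move=> i y.
  - by move=> i.
  - by move=> i; rewrite bm; exact: phir.
rewrite ge0_integralZl//.
- rewrite mulrCA [X in (_ <= X%:E)%E]mulrC [leRHS]EFinM lee_wpmul2l//.
    by rewrite lee_fin mulr_ge0// prodr_ge0.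
  exact: phir.
- by apply/measurable_EFinP; exact: mphi.
- by move=> x _; rewrite lee_fin.
- by rewrite lee_fin mulr_ge0// prodr_ge0.
Qed.

End gauss.

(** * Posterior ratios and truncated masses *)

Section contraction.
Context {d1} {Theta : measurableType d1} {d2} {Y : measurableType d2} {R : realType}.
Variables (P : probability Y R) (nu : {sigma_finite_measure set Theta -> \bar R}).
Local Open Scope ereal_scope.

Section mass.
Variable r : Theta * Y -> R.
Hypotheses (r0 : forall p, (0 <= r p)%R) (mr : measurable_fun setT r).

Definition mass (A : set Theta) (y : Y) : \bar R :=
  \int[nu]_t (\1_A t * r (t, y))%:E.

Lemma mass_ge0 A y : 0 <= mass A y.
Proof. by apply: integral_ge0 => t _; rewrite lee_fin mulr_ge0. Qed.

Let measurable_restr (A : set Theta) : measurable A ->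
  measurable_fun setT (fun p : Theta * Y => (\1_A p.1 * r p)%:E).
Proof.
move=> mA; apply/measurable_EFinP; apply: measurable_funM => //.
by apply: measurableT_comp; [exact: measurable_indic|exact: measurable_fst].
Qed.

Let measurable_restr1 (A : set Theta) y : measurable A ->
  measurable_fun setT (fun t => (\1_A t * r (t, y))%:E).
Proof.
move=> mA.
apply: (measurableT_comp (measurable_restr _ mA) (measurable_pair2 y)).
Qed.

Lemma measurable_mass A : measurable A -> measurable_fun setT (mass A).
Proof.
move=> mA.
apply: (measurable_fun_fubini_tonelli_G
  (fun p : Theta * Y => (\1_A p.1 * r p)%:E)).
  exact: measurable_restr.
by move=> p; rewrite lee_fin mulr_ge0.
Qed.

Lemma le_mass A B y : measurable A -> measurable B -> A `<=` B ->
  mass A y <= mass B y.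
Proof.
move=> mA mB AB; apply: ge0_le_integral_nomeas => t; rewrite lee_fin.
  by rewrite mulr_ge0.
apply: ler_wpM2r => //; rewrite !indicE ler_nat.
have [/set_mem/AB/mem_set -> //|//] := boolP (t \in A).
Qed.

Lemma massU A B y : measurable A -> measurable B ->
  mass (A `|` B) y <= mass A y + mass B y.
Proof.
move=> mA mB; rewrite -ge0_integralD//; last 4 first.
- by move=> t _; rewrite lee_fin mulr_ge0.
- exact: measurable_restr1.
- by move=> t _; rewrite lee_fin mulr_ge0.
- exact: measurable_restr1.
apply: ge0_le_integral_nomeas => t; first by rewrite lee_fin mulr_ge0.
rewrite -EFinD lee_fin -mulrDl; apply: ler_wpM2r => //.
by rewrite !indicE in_setU; case: (t \in A); case: (t \in B) => //=; lra.
Qed.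

(** Tonelli puts the prior integral outside, where the sampling integral is bounded parameter by
    parameter. It is applied with [v] constant 1 for the denominator and with the inverse of a test
    for the numerator. *)
Lemma expect_mass_le (A : set Theta) (v : Y -> R) (w : Theta -> R) (b c : R) :
  measurable A -> measurable_fun setT v -> (forall y, 0 <= v y)%R ->
  measurable_fun setT w -> (forall t, 0 <= w t)%R -> (0 <= b)%R ->
  (forall t, A t -> \int[P]_y (v y * r (t, y))%:E <= (b * w t)%:E) ->
  \int[nu]_t (\1_A t * w t)%:E <= c%:E ->
  \int[P]_y ((v y)%:E * mass A y) <= (b * c)%:E.
Proof.
move=> mA mv v0 mw w0 b0 hA hc.
pose F (p : Theta * Y) := (v p.2 * (\1_A p.1 * r p))%:E.
have mF : measurable_fun setT F.
  rewrite /F; under eq_fun do rewrite EFinM.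
  apply: emeasurable_funM; last exact: measurable_restr.
  by apply/measurable_EFinP; apply: measurableT_comp.
have F0 p : 0 <= F p by rewrite lee_fin !mulr_ge0.
have -> : \int[P]_y ((v y)%:E * mass A y) = \int[P]_y \int[nu]_t F (t, y).
  apply: eq_integral => y _; rewrite /mass -ge0_integralZl//.
  - exact: measurable_restr1.
  - by move=> t _; rewrite lee_fin mulr_ge0.
  - by rewrite lee_fin.
rewrite -fubini_tonelli//.
apply: (@le_trans _ _ (\int[nu]_t (b%:E * (\1_A t * w t)%:E))); last first.
  rewrite ge0_integralZl//.
  - by rewrite EFinM lee_wpmul2l// lee_fin.
  - apply/measurable_EFinP; apply: measurable_funM => //.
  - by move=> t _; rewrite lee_fin mulr_ge0.
apply: ge0_le_integral_nomeas => t.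
  by apply: integral_ge0 => y _; exact: F0.
have [At|At] := boolP (t \in A); last first.
  rewrite integral0_eq; first by rewrite -EFinM lee_fin !mulr_ge0.
  by move=> y _; rewrite /F/= indicE (negbTE At) mul0r mulr0.
under eq_integral do rewrite /F/= indicE At mul1r.
by rewrite indicE At mul1r -EFinM; apply: hA; exact: set_mem.
Qed.

Section truncated.
Variable delta : R.
Hypothesis delta0 : (0 < delta)%R.

(** When the total mass is at least [delta], the posterior mass of [A] is at most 1 and at most its
    own mass over [delta]; this is the expectation of the smaller bound. *)
Definition trunc_mass A := \int[P]_y mine 1 ((delta^-1)%:E * mass A y).

Lemma measurable_trunc A : measurable A ->
  measurable_fun setT (fun y => mine 1 ((delta^-1)%:E * mass A y)).
Proof.
move=> mA; apply: measurable_mine => //.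
by apply: measurable_funeM; exact: measurable_mass.
Qed.

Lemma trunc_ge0 A y : 0 <= mine 1 ((delta^-1)%:E * mass A y).
Proof.
rewrite le_min lee01 mule_ge0 ?mass_ge0// lee_fin invr_ge0 ltW//.
Qed.

Lemma le_trunc_mass A B : measurable A -> measurable B -> A `<=` B ->
  trunc_mass A <= trunc_mass B.
Proof.
move=> mA mB AB; apply: ge0_le_integral_nomeas => y; first exact: trunc_ge0.
rewrite le_min !ge_min lexx/=; apply/orP; right.
by apply: lee_wpmul2l; [rewrite lee_fin invr_ge0 ltW|exact: le_mass].
Qed.

Lemma trunc_massU A B : measurable A -> measurable B ->
  trunc_mass (A `|` B) <= trunc_mass A + trunc_mass B.
Proof.
move=> mA mB; rewrite -ge0_integralD//; last 4 first.
- by move=> y _; exact: trunc_ge0.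
- exact: measurable_trunc.
- by move=> y _; exact: trunc_ge0.
- exact: measurable_trunc.
apply: ge0_le_integral_nomeas => y; first exact: trunc_ge0.
have := massU _ _ y mA mB; have := mass_ge0 A y; have := mass_ge0 B y.
move: (mass _ y) (mass A y) (mass B y) => u a b b0 a0 uab.
have d0 : 0 <= (delta^-1)%:E by rewrite lee_fin invr_ge0 ltW.
have {}uab : (delta^-1)%:E * u <= (delta^-1)%:E * a + (delta^-1)%:E * b.
  by rewrite -ge0_muleDr//; exact: lee_wpmul2l.
have {}a0 := mule_ge0 d0 a0; have {}b0 := mule_ge0 d0 b0.
have [a1|a1] := leP 1 ((delta^-1)%:E * a).
  by rewrite ge_min leeDl// le_min lee01.
have [b1|b1] := leP 1 ((delta^-1)%:E * b).
  by rewrite ge_min leeDr.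
by rewrite ge_min uab orbT.
Qed.

Lemma trunc_mass_bigcup (I : eqType) (c : seq I) (A : I -> set Theta) (e : R) :
  (forall i, measurable (A i)) ->
  (forall i, i \in c -> trunc_mass (A i) <= e%:E) ->
  trunc_mass (\big[setU/set0]_(i <- c) A i) <= ((size c)%:R * e)%:E.
Proof.
move=> mA; elim: c => [|i c IH] h.
  rewrite mul0r big_nil /trunc_mass integral0_eq// => y _.
  rewrite /mass integral0_eq ?mule0 ?min_r// => t _.
  by rewrite indicE memNset ?mul0r.
have hc j : j \in c -> trunc_mass (A j) <= e%:E.
  by move=> jc; apply: h; rewrite inE jc orbT.
rewrite big_cons -[(size (i :: c))%:R]natr1 mulrDl mul1r addrC EFinD.
apply: (le_trans (trunc_massU _ _ _ _)) => //.
  by apply: bigsetU_measurable => j _; exact: mA.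
by apply: leeD; [apply: h; rewrite inE eqxx|exact: IH].
Qed.

(* min(1, x) <= v + x / v for every v > 0: the function v plays the role of a
   test of the sampling law against the alternative A *)
Lemma trunc_mass_le (A : set Theta) (v : Y -> R) (w : Theta -> R) (a b c : R) :
  measurable A -> measurable_fun setT v -> measurable_fun setT (fun y => (v y)^-1%R) ->
  (forall y, 0 < v y)%R ->
  measurable_fun setT w -> (forall t, 0 <= w t)%R -> (0 <= b)%R ->
  \int[P]_y (v y)%:E <= a%:E ->
  (forall t, A t -> \int[P]_y ((v y)^-1 * r (t, y))%:E <= (b * w t)%:E) ->
  \int[nu]_t (\1_A t * w t)%:E <= c%:E ->
  trunc_mass A <= (a + delta^-1 * (b * c))%:E.
Proof.
move=> mA mv mvi v0 mw w0 b0 hv hA hc.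
have vi0 y : (0 <= (v y)^-1)%R by rewrite invr_ge0 ltW.
have vm0 y : 0 <= ((v y)^-1)%:E * mass A y.
  by rewrite mule_ge0 ?mass_ge0// lee_fin.
have d0 : (0 <= delta^-1)%R by rewrite invr_ge0 ltW.
have mm : measurable_fun setT (fun y => ((v y)^-1)%:E * mass A y).
  apply: emeasurable_funM; last exact: measurable_mass.
  exact/measurable_EFinP.
apply: (@le_trans _ _ (\int[P]_y ((v y)%:E +
    (delta^-1)%:E * (((v y)^-1)%:E * mass A y)))).
  apply: ge0_le_integral_nomeas => y; first exact: trunc_ge0.
  have [v1|v1] := leP 1%R (v y).
    rewrite ge_min; apply/orP; left; apply: (@le_trans _ _ (v y)%:E) => //.
    by rewrite leeDl// mule_ge0.
  rewrite ge_min; apply/orP; right.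
  apply: (@le_trans _ _ ((delta^-1)%:E * (((v y)^-1)%:E * mass A y))).
    apply: lee_wpmul2l; first by rewrite lee_fin.
    rewrite -[leLHS]mul1e lee_wpmul2r ?mass_ge0// lee_fin.
    by rewrite invf_ge1// ltW.
  by rewrite leeDr// lee_fin ltW.
rewrite ge0_integralD//; first last.
- exact: measurable_funeM.
- by move=> y _; rewrite mule_ge0// lee_fin.
- exact/measurable_EFinP.
- by move=> y _; rewrite lee_fin ltW.
rewrite ge0_integralZl// EFinD EFinM; apply: leeD => //.
apply: lee_wpmul2l; first by rewrite lee_fin.
exact: (expect_mass_le A _ w).
Qed.

End truncated.
End mass.

(** * Lower bound on the denominator through the reciprocal likelihood ratio *)

Section posterior.
Variables (r r' : Theta * Y -> R) (w : Theta -> R) (A B : set Theta)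
  (b pB : R) (delta : R).
Hypotheses (r0 : forall p, (0 <= r p)%R) (mr : measurable_fun setT r).
Hypotheses (r'0 : forall p, (0 <= r' p)%R) (mr' : measurable_fun setT r').
Hypotheses (w0 : forall t, (0 <= w t)%R) (mw : measurable_fun setT w).
Hypotheses (wrr : forall p, (w p.1 ^+ 2 <= r p * r' p)%R).
Hypotheses (mA : measurable A) (mB : measurable B).
Hypotheses (pB0 : (0 < pB)%R) (b0 : (0 <= b)%R) (delta0 : (0 < delta)%R).
Hypothesis pBE : \int[nu]_t (\1_B t * w t)%:E = pB%:E.

(* If the total mass is below [delta] then, by AM-GM
   [2 w <= c r + r' / c] with [c = pB / delta], the [r']-mass of [B] is large. *)
Let small_mass y : mass r setT y < delta%:E ->
  1 <= (delta / pB ^+ 2)%:E * mass r' B y.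
Proof.
move=> small.
have c0 : (0 < pB / delta)%R by rewrite divr_gt0.
have mBr : measurable_fun setT (fun t => (\1_B t * r (t, y))%:E).
  apply/measurable_EFinP; apply: measurable_funM; first exact: measurable_indic.
  by apply: measurableT_comp => //; exact: measurable_pair2.
have mBr' : measurable_fun setT (fun t => (\1_B t * r' (t, y))%:E).
  apply/measurable_EFinP; apply: measurable_funM; first exact: measurable_indic.
  by apply: measurableT_comp => //; exact: measurable_pair2.
have mBw : measurable_fun setT (fun t => (\1_B t * w t)%:E).
  by apply/measurable_EFinP; apply: measurable_funM => //.
have amgm : 2%:E * pB%:E <=
    (pB / delta)%:E * mass r B y + (delta / pB)%:E * mass r' B y.
  rewrite -pBE /mass -!ge0_integralZl//; try
    (by move=> t _; rewrite lee_fin mulr_ge0); try (by rewrite lee_fin divr_ge0// ltW);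
    try (by rewrite lee_fin); try exact: mBw; try exact: mBr; try exact: mBr'.
  rewrite -ge0_integralD//; last 4 first.
  - by move=> t _; rewrite -EFinM lee_fin !mulr_ge0// ?invr_ge0 ltW.
  - exact: measurable_funeM.
  - by move=> t _; rewrite -EFinM lee_fin !mulr_ge0// ?invr_ge0 ltW.
  - exact: measurable_funeM.
  apply: ge0_le_integral_nomeas => t.
    by rewrite -EFinM lee_fin !mulr_ge0.
  rewrite -!EFinM -EFinD lee_fin.
  set c := (pB / delta)%R in c0 *.
  have -> : (delta / pB = c^-1)%R by rewrite invf_div.
  have -> : (2 * (\1_B t * w t) = \1_B t * (2 * w t) :> R)%R by ring.
  have -> : (c * (\1_B t * r (t, y)) + c^-1 * (\1_B t * r' (t, y)) =
    \1_B t * (c * r (t, y) + c^-1 * r' (t, y)))%R by ring.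
  apply: ler_wpM2l => //.
  have ww := wrr (t, y); rewrite /= in ww.
  have s0 : (0 <= c * r (t, y) + c^-1 * r' (t, y))%R.
    by rewrite addr_ge0// mulr_ge0// ?invr_ge0 ltW.
  rewrite -(@ler_pXn2r _ 2)// ?nnegrE ?mulr_ge0//.
  have cc : (c * c^-1 = 1)%R by rewrite divff// gt_eqF.
  apply: (@le_trans _ _ (4 * (r (t, y) * r' (t, y)))%R).
    by rewrite exprMn; lra.
  have -> : (4 * (r (t, y) * r' (t, y)) =
    4 * ((c * r (t, y)) * (c^-1 * r' (t, y))))%R.
    by rewrite mulrACA cc mul1r.
  move: (c * _)%R (c^-1 * _)%R => u v.
  have -> : ((u + v) ^+ 2 = 4 * (u * v) + (u - v) ^+ 2)%R by ring.
  by rewrite lerDl sqr_ge0.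
have mBs : mass r B y < delta%:E.
  by apply: le_lt_trans small; apply: le_mass.
(* The reason for [c = pB / delta]: the [r] term takes at most half of [2 pB], so the [r'] term
   keeps at least [pB]. *)
have : (pB / delta)%:E * mass r B y <= pB%:E.
  apply: (@le_trans _ _ ((pB / delta)%:E * delta%:E)).
    by apply: lee_wpmul2l; [rewrite lee_fin ltW|exact: ltW].
  by rewrite -EFinM divfK// gt_eqF.
move: amgm; have := mass_ge0 _ r'0 B y; have := mass_ge0 _ r0 B y.
case: (mass r B y) mBs => [u|//|//] _.
case: (mass r' B y) => [v| |//] u0 v0; last first.
  by move=> _ _; rewrite mulry gtr0_sg ?mul1e ?leey// divr_gt0// exprn_gt0.
rewrite -!EFinM -EFinD !lee_fin => h1 h2.
have h3 : (pB <= delta / pB * v)%R by lra.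
have -> : (delta / pB ^+ 2 * v = (delta / pB * v) / pB)%R by field; rewrite gt_eqF.
by rewrite ler_pdivlMr// mul1r.
Qed.

(** Below [delta] the quotient is at most 1 and [small_mass] makes the first term at least 1; above
    [delta] the truncated term suffices. Since [fine] sends an infinite total mass to 0 and division
    by 0 gives 0, degenerate quotients are 0 and the bound holds for every [y]. *)
Lemma ratio_le y : (fine (mass r A y) / fine (mass r setT y))%:E <=
  (delta / pB ^+ 2)%:E * mass r' B y + mine 1 ((delta^-1)%:E * mass r A y).
Proof.
have J0 : 0 <= (delta / pB ^+ 2)%:E * mass r' B y.
  by rewrite mule_ge0 ?mass_ge0// lee_fin; apply: ltW; rewrite divr_gt0 ?exprn_gt0.
have := le_mass _ r0 _ _ y mA measurableT (@subsetT _ A).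
have T0 := trunc_ge0 _ r0 _ delta0 A y.
have rhs0 := adde_ge0 J0 T0.
have := mass_ge0 _ r0 A y.
have [small|big] := ltP (mass r setT y) delta%:E.
  move=> NA0 NAD; have J1 := small_mass _ small.
  apply: (@le_trans _ _ 1); last by rewrite -[leLHS]adde0 leeD.
  case: (mass r setT y) NAD small => [D| |] //; last first.
    by rewrite leeNy_eq => /eqP; case: (mass r A y) NA0.
  case: (mass r A y) NA0 => [N| |] //; rewrite !lee_fin => N0 ND _ /=.
  have [->|D0] := eqVneq D 0%R; first by rewrite invr0 mulr0.
  by rewrite ler_pdivrMr ?mul1r// lt0r D0 (le_trans N0).
move=> NA0 NAD.
apply: (@le_trans _ _ (mine 1 ((delta^-1)%:E * mass r A y))); last by rewrite leeDr.
case: (mass r setT y) NAD big T0 => [D| |] //; last first.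
  by move=> _ _ T0 /=; rewrite invr0 mulr0.
case: (mass r A y) NA0 => [N| |] //; rewrite !lee_fin => N0 ND dD _ /=.
have D0 : (0 < D)%R by exact: lt_le_trans dD.
rewrite le_min -EFinM !lee_fin ler_pdivrMr// mul1r ND/= mulrC ler_wpM2r//.
by rewrite lef_pV2.
Qed.

Lemma expect_ratio_le :
  (forall t, B t -> \int[P]_y (r' (t, y))%:E <= (b * w t)%:E) ->
  \int[P]_y ((delta / pB ^+ 2)%:E * mass r' B y + mine 1 ((delta^-1)%:E * mass r A y))
   <= (delta * b / pB)%:E + trunc_mass r delta A.
Proof.
move=> hB.
have dp0 : (0 <= delta / pB ^+ 2)%R by apply: ltW; rewrite divr_gt0 ?exprn_gt0.
rewrite ge0_integralD//; last 4 first.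
- by move=> y _; rewrite mule_ge0 ?mass_ge0.
- by apply: measurable_funeM; exact: measurable_mass.
- by move=> y _; exact: trunc_ge0.
- exact: measurable_trunc.
apply: leeD => //.
have -> : (delta * b / pB = delta / pB ^+ 2 * (b * pB))%R.
  by field; rewrite gt_eqF.
rewrite ge0_integralZl//; last 2 first.
- exact: measurable_mass.
- by move=> y _; exact: mass_ge0.
rewrite [leRHS]EFinM lee_wpmul2l//.
under eq_integral do rewrite -[mass r' B _]mul1e.
apply: (expect_mass_le _ r'0 mr' _ (cst 1%R) w) => //.
- by move=> t Bt; under eq_integral do rewrite mul1r; exact: hB.
- by rewrite pBE.
Qed.

End posterior.
End contraction.

(** * Gaussian integrals of exponentials of quadratic forms *)

Section exp_bounds.
Context {R : realType}.
Implicit Types x u w r : R.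

(** Via [expR y >= 1 + y], estimates of the normalising factor of a tilted Gaussian become
    polynomial inequalities; [sqrt_inv_le] then replaces w^(-1/2) by e^r. *)
Lemma ge1_mul_expR w y r : 0 < w -> 1 <= w * (1 + y) -> y <= 2 * r ->
  1 <= w * expR (2 * r) :> R.
Proof.
move=> w0 wy yr; apply: (le_trans wy); rewrite ler_pM2l//.
by apply: le_trans (expR_ge1Dx _); rewrite lerD2l.
Qed.

Lemma one_plus_expR x : 0 <= x -> 1 <= (1 + x) * expR (2 * ((- x + x ^+ 2) / 2)).
Proof.
move=> x0; apply: (@ge1_mul_expR _ (- x + x ^+ 2)); [lra| |lra].
have -> : (1 + x) * (1 + (- x + x ^+ 2)) = 1 + x ^+ 3 by ring.
by rewrite lerDl exprn_ge0.
Qed.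

Lemma one_minus_expR x : 0 <= x -> x <= 1 / 2 ->
  1 <= (1 - x) * expR (2 * (x / 2 + x ^+ 2)).
Proof.
move=> x0 x1; apply: (@ge1_mul_expR _ (x + 2 * x ^+ 2)); [lra| |lra].
have -> : (1 - x) * (1 + (x + 2 * x ^+ 2)) = 1 + x ^+ 2 * (1 - 2 * x) by ring.
by rewrite lerDl mulr_ge0 ?sqr_ge0//; lra.
Qed.

Lemma sqrt_inv_le w r : 0 < w -> 1 <= w * expR (2 * r) ->
  (Num.sqrt w)^-1 <= expR r.
Proof.
move=> w0 h; rewrite -[leLHS]mul1r ler_pdivrMr ?sqrtr_gt0//.
rewrite -(@ler_pXn2r _ 2)//; last 2 first.
- by rewrite nnegrE.
- by rewrite nnegrE mulr_ge0 ?expR_ge0 ?sqrtr_ge0.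
by rewrite expr1n exprMn sqr_sqrtr ?(ltW w0)// mulrC -expRM_natl.
Qed.

End exp_bounds.

Section gaussian_integrals.
Context {R : realType}.
Implicit Types m s a b c x : R.

(** Completing the square: the integrand is [K] times the density of N(m1, s1^2) with s1^2 = sg^2 /
    w, and [0 < w] is the integrability condition. *)
Lemma integral_normal_quad m sg m0 a b c : 0 < sg -> 0 < 1 - 2 * a * sg ^+ 2 ->
  (\int[lebesgue_measure]_x
     (normal_pdf m sg x * expR (a * (x - m0) ^+ 2 + b * (x - m0) + c))%:E =
   ((Num.sqrt (1 - 2 * a * sg ^+ 2))^-1 *
    expR ((2 * a * (m - m0) ^+ 2 + 2 * b * (m - m0) + b ^+ 2 * sg ^+ 2) /
          (2 * (1 - 2 * a * sg ^+ 2)) + c))%:E)%E.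
Proof.
move=> sg0; set w := 1 - 2 * a * sg ^+ 2 => w0.
set K := _^-1 * expR _.
pose s1 := sg / Num.sqrt w.
pose m1 := m0 + (m - m0 + b * sg ^+ 2) / w.
have sw0 : 0 < Num.sqrt w by rewrite sqrtr_gt0.
have s10 : 0 < s1 by rewrite divr_gt0.
have s1E : s1 ^+ 2 = sg ^+ 2 / w by rewrite exprMn exprVn sqr_sqrtr// ltW.
transitivity (\int[lebesgue_measure]_x (K%:E * (normal_pdf m1 s1 x)%:E))%E.
  apply: eq_integral => x _; rewrite -EFinM; congr EFin.
  rewrite !normal_pdfE ?gt_eqF// /normal_peak /normal_fun s1E.
  have -> : sg ^+ 2 / w * pi *+ 2 = w^-1 * (sg ^+ 2 * pi *+ 2).
    by rewrite -!mulrnAr; ring.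
  rewrite sqrtrM ?invr_ge0 ?ltW// sqrtrV ?ltW// invfM invrK.
  set p := (Num.sqrt (_ *+ 2))^-1.
  rewrite /K -[LHS]mulrA; set E1 := (X in _ = _ * X * _); set E2 := (X in _ = _ * (_ * X)).
  have -> : (Num.sqrt w)^-1 * E1 * (Num.sqrt w * p * E2) = p * (E1 * E2).
    by field; rewrite gt_eqF.
  rewrite /E1 /E2.
  rewrite -!expRD; congr (_ * expR _).
  rewrite /m1.
  have aE : a = (1 - w) / (2 * sg ^+ 2) by rewrite /w; field; rewrite gt_eqF.
  rewrite aE; field.
  by rewrite !gt_eqF.
rewrite ge0_integralZl//.
- by rewrite integral_normal_pdf mule1.
- by apply/measurable_EFinP; exact: measurable_normal_pdf.
- by move=> x _; rewrite lee_fin normal_pdf_ge0.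
- by rewrite lee_fin mulr_ge0 ?invr_ge0 ?sqrtr_ge0 ?expR_ge0.
Qed.

(* log density ratio of N(m, s) to N(m0, s0^2), [s] being a variance; [1 / s] is
   written [expR (- ln s)] so that joint measurability in [s] is immediate. *)
Definition llr1 m0 s0 m s x : R :=
  ln s0 - ln s / 2 + (x - m0) ^+ 2 / (2 * s0 ^+ 2) - (x - m) ^+ 2 * expR (- ln s) / 2.

Lemma normal_pdf_llr1 m0 s0 m s x : 0 < s0 -> 0 < s ->
  normal_pdf m (Num.sqrt s) x = normal_pdf m0 s0 x * expR (llr1 m0 s0 m s x).
Proof.
move=> s00 s_gt0.
have ss0 : 0 < Num.sqrt s by rewrite sqrtr_gt0.
rewrite !normal_pdfE ?gt_eqF// /normal_peak /normal_fun sqr_sqrtr ?ltW//.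
have pk (v : R) : 0 <= v -> Num.sqrt (v * pi *+ 2) = Num.sqrt v * Num.sqrt (pi *+ 2).
  by move=> v0; rewrite -mulrnAr sqrtrM.
rewrite !pk ?sqr_ge0// ?ltW// sqrtr_sqr gtr0_norm// /llr1.
have -> : ln s0 - ln s / 2 + (x - m0) ^+ 2 / (2 * s0 ^+ 2)
   - (x - m) ^+ 2 * expR (- ln s) / 2 = ln s0 - ln (Num.sqrt s) +
   ((x - m0) ^+ 2 / (2 * s0 ^+ 2) - (x - m) ^+ 2 / (2 * s)).
  have -> : ln (Num.sqrt s) = ln s / 2.
    rewrite -[in RHS](sqr_sqrtr (ltW s_gt0)) lnXn//.
    by field.
  by rewrite expRN lnK//; field; rewrite !gt_eqF.
rewrite expRD (expRB (ln s0)) !lnK//.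
set q := Num.sqrt (pi *+ 2); set f0 := (X in _ = _ * X * _).
set E := (X in _ = _ * _ * (_ * X)).
have q0 : 0 < q by rewrite sqrtr_gt0 mulrn_wgt0// pi_gt0.
transitivity ((Num.sqrt s * q)^-1 * (f0 * E)); last by field; rewrite !gt_eqF.
rewrite -expRD; congr (_ * expR _).
by field; rewrite !gt_eqF.
Qed.

Lemma llr1_id m0 s0 x : 0 < s0 -> llr1 m0 s0 m0 (s0 ^+ 2) x = 0.
Proof.
move=> s00; rewrite /llr1 expRN lnK ?posrE ?exprn_gt0// lnXn//.
by field; rewrite gt_eqF.
Qed.

Lemma measurable_llr1 m0 s0 m s : measurable_fun setT (llr1 m0 s0 m s).
Proof.
rewrite /llr1; apply: measurable_funB.
  apply: measurable_funD => //; apply: measurable_funM => //.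
  by apply: measurable_funX; apply: measurable_funB.
do 2 apply: measurable_funM => //.
by apply: measurable_funX; apply: measurable_funB.
Qed.

(** Adding [llr1] to the exponent changes the sampling law to N(m, s), so this is the expectation of
    the quadratic exponential under the alternative. The bound [r] stands for the logarithm of (1 -
    2 a s)^(-1/2). *)
Lemma expect_quad_llr1_le m0 s0 m s a b c r : 0 < s0 -> 0 < s ->
  0 < 1 - 2 * a * s -> 1 <= (1 - 2 * a * s) * expR (2 * r) ->
  (\int[normal_prob m0 s0]_x
     (expR (a * (x - m0) ^+ 2 + b * (x - m0) + c + llr1 m0 s0 m s x))%:E <=
   (expR ((2 * a * (m - m0) ^+ 2 + 2 * b * (m - m0) + b ^+ 2 * s) /
          (2 * (1 - 2 * a * s)) + c + r))%:E)%E.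
Proof.
move=> s00 s_gt0 w0 wr.
have ss : (Num.sqrt s) ^+ 2 = s by rewrite sqr_sqrtr ?ltW.
rewrite normal_prob_integral; last 2 first.
- apply/measurable_EFinP; apply: measurableT_comp => //.
  apply: measurable_funD; last exact: measurable_llr1.
  apply: measurable_funD => //; apply: measurable_funD => //.
    by apply: measurable_funM => //; apply: measurable_funX; apply: measurable_funB.
  by apply: measurable_funM => //; apply: measurable_funB.
- by move=> x; rewrite lee_fin expR_ge0.
rewrite (_ : (\int[_]_x _)%E = (\int[lebesgue_measure]_x (normal_pdf m (Num.sqrt s) x *
    expR (a * (x - m0) ^+ 2 + b * (x - m0) + c))%:E)%E); last first.
  apply: eq_integral => x _; rewrite -EFinM; congr EFin.
  rewrite (normal_pdf_llr1 m0 s0)// expRD; ring.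
rewrite integral_normal_quad ?sqrtr_gt0// ss//.
rewrite lee_fin [leRHS]expRD mulrC; apply: ler_wpM2l; first exact: expR_ge0.
exact: sqrt_inv_le.
Qed.

Lemma expect_quad_le m0 s0 a b c r : 0 < s0 ->
  0 < 1 - 2 * a * s0 ^+ 2 -> 1 <= (1 - 2 * a * s0 ^+ 2) * expR (2 * r) ->
  (\int[normal_prob m0 s0]_x
     (expR (a * (x - m0) ^+ 2 + b * (x - m0) + c))%:E <=
   (expR ((b ^+ 2 * s0 ^+ 2) / (2 * (1 - 2 * a * s0 ^+ 2)) + c + r))%:E)%E.
Proof.
move=> s00 w0 wr.
have := expect_quad_llr1_le m0 s0 m0 (s0 ^+ 2) a b c r s00 (exprn_gt0 _ s00) w0 wr.
rewrite subrr expr0n/= !mulr0 !add0r.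
by under eq_integral do rewrite llr1_id// addr0.
Qed.

(* With [s = s0^2 (1 + u)]: the chi-square affinity of two normal laws. *)
Lemma expect_llr1_inv_le m0 s0 m u : 0 < s0 -> `|u| <= 1 / 4 ->
  (\int[normal_prob m0 s0]_x (expR (- llr1 m0 s0 m (s0 ^+ 2 * (1 + u)) x))%:E <=
   (expR (2 * (m - m0) ^+ 2 / s0 ^+ 2 + u ^+ 2))%:E)%E.
Proof.
move=> s00; rewrite ler_norml => /andP[u1 u2].
set s := s0 ^+ 2 * (1 + u).
have s02 : 0 < s0 ^+ 2 by rewrite exprn_gt0.
have u10 : 0 < 1 + u by lra.
have s_gt0 : 0 < s by rewrite mulr_gt0.
(* [a], [b], [c] are the coefficients of [- llr1] expanded in powers of [x - m0]. Integrability
   becomes 1 + 2 u > 0, which the bound on [u] ensures. *)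
pose a := 1 / (2 * s) - 1 / (2 * s0 ^+ 2).
have wE : 1 - 2 * a * s0 ^+ 2 = (1 + 2 * u) / (1 + u).
  by rewrite /a /s; field; rewrite !gt_eqF.
have w0 : 0 < 1 - 2 * a * s0 ^+ 2 by rewrite wE divr_gt0//; lra.
pose b := - (m - m0) / s.
pose c := (m - m0) ^+ 2 / (2 * s) + ln s / 2 - ln s0.
(* Chosen so that the logarithms in [c + r] cancel and only [u ^+ 2] remains. *)
pose r := u ^+ 2 - (ln s / 2 - ln s0).
have wr : 1 <= (1 - 2 * a * s0 ^+ 2) * expR (2 * r).
  have -> : 2 * r = 2 * u ^+ 2 - ln (1 + u).
    by rewrite /r /s lnM ?posrE// lnXn//; field.
  rewrite expRB lnK ?posrE// wE.
  have -> : (1 + 2 * u) / (1 + u) * (expR (2 * u ^+ 2) / (1 + u)) =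
     ((1 + 2 * u) / (1 + u) ^+ 2) * expR (2 * u ^+ 2).
    by field; rewrite gt_eqF.
  apply: (@ge1_mul_expR _ _ (2 * u ^+ 2)) => //.
    by rewrite divr_gt0 ?exprn_gt0//; lra.
  rewrite mulrAC ler_pdivlMr ?exprn_gt0// mul1r -subr_ge0.
  have -> : (1 + 2 * u) * (1 + 2 * u ^+ 2) - (1 + u) ^+ 2 =
    u ^+ 2 * (1 + 4 * u) by ring.
  by rewrite mulr_ge0 ?sqr_ge0//; lra.
have := expect_quad_le m0 s0 a b c r s00 w0 wr.
rewrite (_ : (\int[_]_x _)%E = (\int[normal_prob m0 s0]_x
    (expR (- llr1 m0 s0 m s x))%:E)%E); last first.
  apply: eq_integral => x _; congr (expR _)%:E.
  rewrite /llr1 expRN lnK// /a /b /c; field.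
  by rewrite !gt_eqF.
move=> /le_trans; apply; rewrite lee_fin ler_expR wE.
rewrite -subr_ge0.
have -> : 2 * (m - m0) ^+ 2 / s0 ^+ 2 + u ^+ 2 -
    (b ^+ 2 * s0 ^+ 2 / (2 * ((1 + 2 * u) / (1 + u))) + c + r) =
   (m - m0) ^+ 2 / s0 ^+ 2 * (2 - 1 / (1 + 2 * u)).
  rewrite /b /c /r /s; field.
  by rewrite !gt_eqF//; lra.
rewrite mulr_ge0// ?divr_ge0 ?sqr_ge0// subr_ge0 ler_pdivrMr//; lra.
Qed.

End gaussian_integrals.

(** * The model in the coordinates (mu, s) with s = sigma^2 *)

Section likelihood_ratio.
Context {R : realType} {n : nat}.
Local Notation TR := (measurableTypeR R).
Implicit Types (mu y : n.-tuple R) (s : R).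

Definition llr (m0 : n.-tuple R) (s0 : R) mu s y : R :=
  \sum_(i < n) llr1 (tnth m0 i) s0 (tnth mu i) s (tnth y i).

Lemma lik_gt0 y mu s : 0 < s -> 0 < lik y mu s.
Proof.
move=> s_gt0; apply: prodr_gt0 => i _.
by rewrite normal_pdfE ?gt_eqF// mulr_gt0 ?expR_gt0// normal_peak_gt0 ?gt_eqF.
Qed.

Lemma lik_llr m0 s0 mu s y : 0 < s0 -> 0 < s ->
  lik y mu (Num.sqrt s) = lik y m0 s0 * expR (llr m0 s0 mu s y).
Proof.
move=> s00 s_gt0; rewrite /lik /llr expR_sum -big_split/=.
by apply: eq_bigr => i _; exact: normal_pdf_llr1.
Qed.

(** Logarithm of a test. The variance tests are radial ([b] zero), the mean test is linear ([a]
    zero), so one [a] common to all coordinates suffices. *)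
Definition qform (m0 : n.-tuple R) (a : R) (b c : 'I_n -> R) y : R :=
  \sum_(i < n) (a * (tnth y i - tnth m0 i) ^+ 2 + b i * (tnth y i - tnth m0 i) + c i).

Lemma gauss_expect_expR_sum_le m0 s0 (e : 'I_n -> R -> R) (q : 'I_n -> R) :
  (forall i, measurable_fun setT (e i)) ->
  (forall i, \int[normal_prob (tnth m0 i) s0]_x (expR (e i x))%:E <= (expR (q i))%:E)%E ->
  (gauss_expect m0 s0 (fun y => (expR (\sum_(i < n) e i (tnth y i)))%:E) <=
   (expR (\sum_(i < n) q i))%:E)%E.
Proof.
move=> me h; rewrite expR_sum.
rewrite (_ : (fun y => _) =
  (fun y => (1 * \prod_(i < n) (expR \o e i) (tnth y i))%:E)); last first.
  by apply/funext => y; rewrite mul1r expR_sum.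
rewrite -[X in (_ <= X%:E)%E]mul1r.
apply: (gauss_expect_prod_le _ m0 s0 1 (fun i => expR \o e i)
  (fun i => expR (q i))) => //.
- by move=> i x /=; exact: expR_ge0.
- by move=> i; apply: measurableT_comp.
Qed.

Lemma measurable_quad (c0 a b c : R) :
  measurable_fun setT (fun x : R => a * (x - c0) ^+ 2 + b * (x - c0) + c).
Proof.
apply: measurable_funD => //; apply: measurable_funD => //.
  by apply: measurable_funM => //; apply: measurable_funX; apply: measurable_funB.
by apply: measurable_funM => //; apply: measurable_funB.
Qed.

Lemma expect_qform_llr_le m0 s0 mu s a b c r : 0 < s0 -> 0 < s ->
  0 < 1 - 2 * a * s -> 1 <= (1 - 2 * a * s) * expR (2 * r) ->
  (gauss_expect m0 s0 (fun y => (expR (qform m0 a b c y + llr m0 s0 mu s y))%:E) <=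
   (expR (\sum_(i < n) ((2 * a * (tnth mu i - tnth m0 i) ^+ 2 +
      2 * b i * (tnth mu i - tnth m0 i) + b i ^+ 2 * s) / (2 * (1 - 2 * a * s)) + c i + r)))%:E)%E.
Proof.
move=> s00 s_gt0 w0 wr; rewrite /qform /llr.
under eq_fun do rewrite -big_split/=.
apply: (gauss_expect_expR_sum_le m0 s0 (fun i x => a * (x - tnth m0 i) ^+ 2 +
  b i * (x - tnth m0 i) + c i + llr1 (tnth m0 i) s0 (tnth mu i) s x)) => i.
  by apply: measurable_funD; [exact: measurable_quad|exact: measurable_llr1].
exact: expect_quad_llr1_le.
Qed.

Lemma expect_qform_le m0 s0 a b c r : 0 < s0 ->
  0 < 1 - 2 * a * s0 ^+ 2 -> 1 <= (1 - 2 * a * s0 ^+ 2) * expR (2 * r) ->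
  (gauss_expect m0 s0 (fun y => (expR (qform m0 a b c y))%:E) <=
   (expR (\sum_(i < n) (b i ^+ 2 * s0 ^+ 2 / (2 * (1 - 2 * a * s0 ^+ 2)) + c i + r)))%:E)%E.
Proof.
move=> s00 w0 wr; apply: (gauss_expect_expR_sum_le m0 s0 (fun i x =>
  a * (x - tnth m0 i) ^+ 2 + b i * (x - tnth m0 i) + c i)) => i.
  exact: measurable_quad.
exact: expect_quad_le.
Qed.

Lemma expect_llr_inv_le m0 s0 mu u : 0 < s0 -> `|u| <= 1 / 4 ->
  (gauss_expect m0 s0 (fun y => (expR (- llr m0 s0 mu (s0 ^+ 2 * (1 + u)) y))%:E) <=
   (expR (\sum_(i < n) (2 * (tnth mu i - tnth m0 i) ^+ 2 / s0 ^+ 2 + u ^+ 2)))%:E)%E.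
Proof.
move=> s00 hu; rewrite /llr.
under eq_fun do rewrite -sumrN.
apply: (gauss_expect_expR_sum_le m0 s0 (fun i x => - llr1 (tnth m0 i) s0 (tnth mu i) _ x)) => i.
  by apply: measurable_funN; exact: measurable_llr1.
exact: expect_llr1_inv_le.
Qed.

Lemma measurable_qform m0 a b c : measurable_fun setT (qform m0 a b c).
Proof.
apply: measurable_sum => i.
apply: (measurableT_comp (measurable_quad (tnth m0 i) a (b i) (c i))).
exact: measurable_tnth.
Qed.

Lemma measurable_llr m0 s0 : measurable_fun setT
  (fun p : (n.-tuple R * TR) * n.-tuple R => llr m0 s0 p.1.1 p.1.2 p.2).
Proof.
have m2 : measurable_fun setT
  (fun p : (n.-tuple R * TR) * n.-tuple R => (p.1.2 : R)).
  by apply: measurable_fun_TR; apply: measurableT_comp.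
have mln : measurable_fun setT
  (fun p : (n.-tuple R * TR) * n.-tuple R => ln (p.1.2 : R)).
  by apply: (measurableT_comp (@measurable_ln R)).
apply: measurable_sum => i; rewrite /llr1.
have m1 : measurable_fun setT
  (fun p : (n.-tuple R * TR) * n.-tuple R => tnth p.1.1 i).
  by apply: (measurableT_comp (measurable_tnth i)); apply: measurableT_comp.
have m3 : measurable_fun setT
  (fun p : (n.-tuple R * TR) * n.-tuple R => tnth p.2 i).
  by apply: (measurableT_comp (measurable_tnth i)).
apply: measurable_funB.
  apply: measurable_funD.
    by apply: measurable_funB => //; apply: measurable_funM.
  by apply: measurable_funM => //; apply: measurable_funX; apply: measurable_funB.
apply: measurable_funM => //; apply: measurable_funM.
  by apply: measurable_funX; apply: measurable_funB.
by apply: (measurableT_comp (@measurable_expR R)); apply: measurable_funN.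
Qed.

Lemma measurable_sqdist (mu0 : n.-tuple R) : measurable_fun setT (fun mu => sqdist mu mu0).
Proof.
apply: measurable_sum => i; apply: measurable_funX; apply: measurable_funB => //.
exact: measurable_tnth.
Qed.

End likelihood_ratio.

(** * The posterior as a quotient of masses relative to the true law *)

Section posterior_bound.
Context {R : realType} {n : nat}.
Local Notation TR := (measurableTypeR R).
Local Notation leb := (@lebesgue_measure R).
Variables (Pmu : probability (n.-tuple R) R) (g : R -> R).
Hypothesis g0 : forall s : R, 0 < s -> 0 <= g s.
Hypothesis mg : measurable_fun (`]0%R, +oo[%classic : set R) g.
Variables (m0 : n.-tuple R) (s0 : R).
Hypothesis s00 : 0 < s0.

Definition prior_w (t : n.-tuple R * TR) : R := \1_(`]0, +oo[%classic : set R) t.2 * g t.2.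

Definition wlr (p : (n.-tuple R * TR) * n.-tuple R) : R :=
  prior_w p.1 * expR (llr m0 s0 p.1.1 p.1.2 p.2).

(** Only the likelihood ratio is inverted, the prior density is kept: the product with [wlr] is then
    [prior_w ^+ 2], as the Cauchy-Schwarz argument requires. *)
Definition wlr_inv (p : (n.-tuple R * TR) * n.-tuple R) : R :=
  prior_w p.1 * expR (- llr m0 s0 p.1.1 p.1.2 p.2).

Lemma measurable_density : measurable_fun setT
  (fun s : R => \1_(`]0, +oo[%classic : set R) s * g s).
Proof.
rewrite (_ : (fun s => _) = g \_ (`]0, +oo[%classic : set R)).
  apply/(measurable_restrictT _ _).1 => //.
apply/funext => s; rewrite patchE indicE.
by case: (s \in _); rewrite ?mul1r ?mul0r.
Qed.

Lemma density_ge0 (s : R) : 0 <= \1_(`]0, +oo[%classic : set R) s * g s.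
Proof.
rewrite indicE; case: (boolP (s \in _)) => [|_]; last by rewrite mul0r.
by rewrite inE/= in_itv/= andbT mul1r => /g0.
Qed.

Lemma measurable_prior_w : measurable_fun setT prior_w.
Proof.
apply: (measurableT_comp measurable_density).
by apply: measurable_fun_TR.
Qed.

Lemma prior_w_ge0 t : 0 <= prior_w t. Proof. exact: density_ge0. Qed.

Lemma measurable_wlr : measurable_fun setT wlr.
Proof.
apply: measurable_funM.
  by apply: (measurableT_comp measurable_prior_w).
by apply: (measurableT_comp (@measurable_expR R)); exact: measurable_llr.
Qed.

Lemma measurable_wlr_inv : measurable_fun setT wlr_inv.
Proof.
apply: measurable_funM.
  by apply: (measurableT_comp measurable_prior_w).
apply: (measurableT_comp (@measurable_expR R)); apply: measurable_funN.
exact: measurable_llr.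
Qed.

Lemma wlr_ge0 p : 0 <= wlr p.
Proof. by rewrite mulr_ge0 ?prior_w_ge0 ?expR_ge0. Qed.

Lemma wlr_inv_ge0 p : 0 <= wlr_inv p.
Proof. by rewrite mulr_ge0 ?prior_w_ge0 ?expR_ge0. Qed.

(* Canonical inference only knows products of (sub)probabilities. *)
Lemma prior_sigma_finite : sigma_finite setT (Pmu \x leb)%E.
Proof.
have [G GT Goo] := sigma_finiteT leb.
exists (fun k => setT `*` G k); first by rewrite -setX_bigcupr -GT setXTT.
move=> k; have [mG Gk] := Goo k; split; first exact: measurableX.
apply: (@le_lt_trans _ _ (Pmu setT * leb (G k))%E).
  by rewrite -product_measure1E.
by rewrite (@probability_setT _ _ _ Pmu) mul1e.
Qed.

(** The second factor is Lebesgue measure, not the prior law of the variance; the density sits in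
    the integrands through [prior_w]. *)
Definition prior_meas : {sigma_finite_measure set (n.-tuple R * TR)%type -> \bar R} :=
  HB.pack (Pmu \x leb)%E
    (Measure_isSigmaFinite.Build _ _ _ (Pmu \x leb)%E prior_sigma_finite).

Lemma integral_prior_meas (f : n.-tuple R * TR -> \bar R) :
  measurable_fun setT f -> (forall t, 0 <= f t)%E ->
  (\int[prior_meas]_t f t = \int[Pmu]_mu \int[leb]_s f (mu, s))%E.
Proof. exact: fubini_tonelli1. Qed.

Definition std_alt (A : set (n.-tuple R * R)) : set (n.-tuple R * TR) :=
  [set t | A (t.1, Num.sqrt (t.2 : R))].

Lemma post_numE A y : measurable (std_alt A) ->
  post_num Pmu g A y = ((lik y m0 s0)%:E * mass prior_meas wlr (std_alt A) y)%E.
Proof.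
move=> mA; rewrite /mass; set h := (fun t => (\1__ t * wlr (t, y))%:E).
have mh : measurable_fun setT h.
  apply/measurable_EFinP; apply: measurable_funM; first exact: measurable_indic.
  exact: (measurableT_comp measurable_wlr (measurable_pair2 y)).
have h0 t : (0 <= h t)%E by rewrite lee_fin mulr_ge0 ?wlr_ge0.
have l0 : (0 <= (lik y m0 s0)%:E)%E by rewrite lee_fin ltW// lik_gt0.
rewrite integral_prior_meas// /post_num -ge0_integralZl//; last 2 first.
- exact: (@measurable_fun_fubini_tonelli_F _ _ _ _ _ _ h).
- by move=> mu _; apply: integral_ge0 => s _; exact: h0.
apply: eq_integral => mu _; rewrite -ge0_integralZl//; last 2 first.
- exact: (measurableT_comp mh (measurable_pair1 mu)).
- by move=> s _; exact: (h0 (mu, s)).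
rewrite /h.
rewrite [LHS]integral_mkcond; apply: eq_integral => s _.
rewrite patchE /wlr /prior_w/= [X in _ = (_ * (_ * (X * _ * _))%:E)%E]indicE/=.
case: ifPn => [sp|sn]; last by rewrite !mul0r mulr0 mule0.
have s_gt0 : 0 < s by move: sp; rewrite inE/= in_itv/= andbT.
rewrite (lik_llr m0 _ _ _ _ s00 s_gt0) -EFinM; congr EFin.
have -> : \1_(std_alt A) (mu, s) = \1_A (mu, Num.sqrt s) :> R by [].
by rewrite mulr1n mul1r; ring.
Qed.

(** Holds at infinite values too, both sides being 0, so the true likelihood cancels from the
    posterior without any finiteness of the masses. *)
Lemma fine_pmul (k : R) (x : \bar R) : 0 < k -> fine (k%:E * x)%E = k * fine x.
Proof.
move=> k0; case: x => [x| |]//=; first by rewrite mulr0 mulry gtr0_sg ?mul1e.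
by rewrite mulr0 mulrNy gtr0_sg ?mul1e.
Qed.

Lemma posteriorE A y : measurable (std_alt A) ->
  posterior Pmu g A y =
  fine (mass prior_meas wlr (std_alt A) y) / fine (mass prior_meas wlr setT y).
Proof.
move=> mA; rewrite /posterior !post_numE//; last exact: measurableT.
have l0 := lik_gt0 y m0 s0 s00.
rewrite !fine_pmul// invfM mulrACA divff ?mul1r// gt_eqF//.
Qed.

Lemma gauss_expect_posterior_le A (B : set (n.-tuple R * TR)) (b pB delta : R)
    (P : probability (n.-tuple R) R) :
  (forall f : n.-tuple R -> \bar R, measurable_fun setT f -> (forall y, 0 <= f y)%E ->
     gauss_expect m0 s0 f = (\int[P]_y f y)%E) ->
  measurable (std_alt A) -> measurable B -> 0 < pB -> 0 <= b -> 0 < delta ->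
  (\int[prior_meas]_t (\1_B t * prior_w t)%:E)%E = pB%:E ->
  (forall t, B t ->
     gauss_expect m0 s0 (fun y => (expR (- llr m0 s0 t.1 t.2 y))%:E) <= b%:E)%E ->
  (gauss_expect m0 s0 (fun y => (posterior Pmu g A y)%:E) <=
   (delta * b / pB)%:E + trunc_mass P prior_meas wlr delta (std_alt A))%E.
Proof.
move=> PE mA mB pB0 b0 d0 pBE hB.
have wrr p : prior_w p.1 ^+ 2 <= wlr p * wlr_inv p.
  by rewrite /wlr /wlr_inv mulrACA -expRD subrr expR0 mulr1 expr2.
have mB' t : B t -> (\int[P]_y (wlr_inv (t, y))%:E <= (b * prior_w t)%:E)%E.
  move=> Bt; have hb := hB t Bt.
  have ml : measurable_fun setT (fun y => (expR (- llr m0 s0 t.1 t.2 y))%:E).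
    apply/measurable_EFinP; apply: (measurableT_comp (@measurable_expR R)).
    apply: measurable_funN.
    exact: (measurableT_comp (measurable_llr m0 s0) (measurable_pair1 t)).
  rewrite /wlr_inv /=; under eq_integral do rewrite EFinM.
  rewrite ge0_integralZl//; last first.
    by rewrite lee_fin prior_w_ge0.
  rewrite [b * _]mulrC [leRHS]EFinM; apply: lee_wpmul2l.
    by rewrite lee_fin prior_w_ge0.
  by rewrite -PE// => y; rewrite lee_fin expR_ge0.
have := expect_ratio_le P prior_meas wlr wlr_inv prior_w (std_alt A) B b pB delta
  wlr_ge0 measurable_wlr wlr_inv_ge0 measurable_wlr_inv
  prior_w_ge0 measurable_prior_w mA mB pB0 b0 d0 pBE mB'.
apply: le_trans.
have mD : measurable_fun setT (fun y => ((delta / pB ^+ 2)%:E * mass prior_meas wlr_inv B y +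
    mine 1 ((delta^-1)%:E * mass prior_meas wlr (std_alt A) y))%E).
  apply: emeasurable_funD.
    by apply: measurable_funeM; exact: measurable_mass wlr_inv_ge0 measurable_wlr_inv _ mB.
  exact: measurable_trunc wlr_ge0 measurable_wlr _ _ mA.
have D0 y : (0 <= (delta / pB ^+ 2)%:E * mass prior_meas wlr_inv B y +
    mine 1 ((delta^-1)%:E * mass prior_meas wlr (std_alt A) y))%E.
  rewrite adde_ge0 ?trunc_ge0//; last by move=> p; exact: wlr_ge0.
  rewrite mule_ge0 ?mass_ge0//; last by move=> p; exact: wlr_inv_ge0.
  by rewrite lee_fin; apply: ltW; rewrite divr_gt0 ?exprn_gt0.
(* The dominating function is measurable, so its [P]-integral is turned back into an iterated
   expectation and the comparison is made there; measurability of the posterior is not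
   established. *)
rewrite -PE//; apply: le_gauss_expect => y; rewrite posteriorE//.
  by rewrite lee_fin divr_ge0// fine_ge0// mass_ge0//; move=> p; exact: wlr_ge0.
exact: (ratio_le prior_meas wlr wlr_inv prior_w (std_alt A) B pB delta
  wlr_ge0 measurable_wlr wlr_inv_ge0 measurable_wlr_inv
  prior_w_ge0 measurable_prior_w wrr mA mB pB0 d0 pBE).
Qed.

End posterior_bound.

(** * Tests on the pieces of the alternative *)

Section regions.
Context {R : realType} {n : nat}.
Local Notation TR := (measurableTypeR R).
Local Notation leb := (@lebesgue_measure R).
Variables (Pmu : probability (n.-tuple R) R) (g : R -> R).
Hypothesis g0 : forall s : R, 0 < s -> 0 <= g s.
Hypothesis mg : measurable_fun (`]0%R, +oo[%classic : set R) g.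
Hypothesis g1 : (\int[leb]_(s in `]0%R, +oo[%classic) (g s)%:E = 1)%E.
Variables (m0 : n.-tuple R) (s0 : R).
Hypothesis s00 : 0 < s0.
Variable P : probability (n.-tuple R) R.
Hypothesis PE : forall f : n.-tuple R -> \bar R, measurable_fun setT f ->
  (forall y, 0 <= f y)%E -> gauss_expect m0 s0 f = (\int[P]_y f y)%E.
Variable delta : R.
Hypothesis delta0 : 0 < delta.
Local Notation prior := (prior_meas Pmu).
Local Notation w := (prior_w g).
Local Notation tmass := (trunc_mass P prior (wlr g m0 s0) delta).

Lemma prior_rect (U : set (n.-tuple R)) (S : set TR) :
  measurable U -> measurable S ->
  (\int[prior]_t (\1_(U `*` S) t * w t)%:E =
   Pmu U * \int[leb]_(s in S `&` `]0%R, +oo[) (g s)%:E)%E.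
Proof.
move=> mU mS.
rewrite integral_prior_meas; last 2 first.
- apply/measurable_EFinP; apply: measurable_funM.
    by apply: measurable_indic; exact: measurableX.
  exact: measurable_prior_w.
- by move=> t; rewrite lee_fin mulr_ge0 ?prior_w_ge0.
transitivity (\int[Pmu]_mu ((\1_U mu)%:E *
   \int[leb]_(s in S `&` `]0%R, +oo[) (g s)%:E))%E.
  apply: eq_integral => mu _.
  have [Umu|Umu] := boolP (mu \in U); last first.
    rewrite indicE (negbTE Umu) mul0e integral0_eq// => s _.
    rewrite indicE memNset ?mul0r// => -[/= Um _].
    by move: Umu; rewrite notin_setE.
  rewrite indicE Umu mul1e [RHS]integral_mkcond; apply: eq_integral => s _.
  rewrite patchE /prior_w/= !indicE.
  have -> : ((mu, s) \in U `*` S) = (s \in S).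
    apply/idP/idP => [/set_mem[_]/mem_set//|/set_mem Ss]; apply/mem_set.
    by split => //=; exact: set_mem.
  rewrite [in RHS]in_setI.
  by case: (s \in S); case: (s \in _); rewrite /= ?mul1r ?mul0r.
rewrite ge0_integralZr//; last 2 first.
- exact/measurable_EFinP/measurable_indic.
- by apply: integral_ge0 => s [_]; rewrite /= in_itv/= andbT lee_fin => /g0.
by rewrite integral_indic// setIT.
Qed.

Lemma prior_mu_mass (U : set (n.-tuple R)) : measurable U ->
  (\int[prior]_t (\1_(U `*` setT) t * w t)%:E = Pmu U)%E.
Proof. by move=> mU; rewrite prior_rect// setTI g1 mule1. Qed.

Lemma prior_mass_le1 (A : set (n.-tuple R * TR)) : measurable A ->
  (\int[prior]_t (\1_A t * w t)%:E <= 1)%E.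
Proof.
move=> mA; rewrite -(@probability_setT _ _ _ Pmu) -prior_mu_mass//.
apply: ge0_le_integral_nomeas => t; rewrite lee_fin.
  by rewrite mulr_ge0 ?prior_w_ge0.
apply: ler_wpM2r; first exact: prior_w_ge0.
by rewrite setXTT !indicE in_setT ler_nat leq_b1.
Qed.

(** The inverse of an exponential quadratic form is again one, with opposite coefficients; so both
    error terms of [trunc_mass_le] are given by the same Gaussian formulas. *)
Lemma trunc_mass_exp_le (A : set (n.-tuple R * TR)) (a : R) (b c : 'I_n -> R)
    (Q1 Q2 pm : R) :
  measurable A ->
  (gauss_expect m0 s0 (fun y => (expR (qform m0 a b c y))%:E) <= (expR Q1)%:E)%E ->
  (forall t, A t -> 0 < (t.2 : R) ->
    (gauss_expect m0 s0 (fun y => (expR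
       (qform m0 (- a) (fun i => - b i) (fun i => - c i) y + llr m0 s0 t.1 t.2 y))%:E)
     <= (expR Q2)%:E)%E) ->
  (\int[prior]_t (\1_A t * w t)%:E <= pm%:E)%E ->
  (tmass A <= (expR Q1 + delta^-1 * (expR Q2 * pm))%:E)%E.
Proof.
move=> mA h1 h2 hpm.
have qN y : qform m0 (- a) (fun i => - b i) (fun i => - c i) y = - qform m0 a b c y.
  by rewrite /qform -sumrN; apply: eq_bigr => i _; ring.
have mV (aa : R) bb cc : measurable_fun setT (fun y => expR (qform m0 aa bb cc y)).
  by apply: (measurableT_comp (@measurable_expR R)); exact: measurable_qform.
apply: (trunc_mass_le P prior (wlr g m0 s0) (wlr_ge0 _ g0 _ _) (measurable_wlr _ mg _ _)
  delta delta0 A (fun y => expR (qform m0 a b c y)) w (expR Q1) (expR Q2) pm) => //.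
- under eq_fun do rewrite -expRN -qN; exact: mV.
- by move=> y; exact: expR_gt0.
- exact: measurable_prior_w.
- exact: prior_w_ge0.
- by rewrite -PE//; apply/measurable_EFinP; exact: mV.
move=> t At.
(* Lebesgue measure also charges nonpositive variances; there the prior weight vanishes. *)
have [t2|t2] := ltP 0 (t.2 : R); last first.
  have -> : w t = 0.
    by rewrite /prior_w indicE memNset ?mul0r//= in_itv/= andbT ltNge t2.
  rewrite integral0_eq ?mulr0// => y _.
  by rewrite /wlr/= [X in X * expR _](_ : _ = 0) ?mul0r ?mulr0// /prior_w
    indicE memNset ?mul0r//= in_itv/= andbT ltNge t2.
have ml : measurable_fun setT (fun y => (expR
    (qform m0 (- a) (fun i => - b i) (fun i => - c i) y + llr m0 s0 t.1 t.2 y))%:E).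
  apply/measurable_EFinP; apply: (measurableT_comp (@measurable_expR R)).
  apply: measurable_funD; first exact: measurable_qform.
  exact: (measurableT_comp (measurable_llr m0 s0) (measurable_pair1 t)).
rewrite (_ : (\int[P]_y _)%E = (\int[P]_y ((w t)%:E * (expR
    (qform m0 (- a) (fun i => - b i) (fun i => - c i) y + llr m0 s0 t.1 t.2 y))%:E))%E).
  rewrite ge0_integralZl//; last first.
    by rewrite lee_fin prior_w_ge0.
  rewrite [expR Q2 * _]mulrC [leRHS]EFinM; apply: lee_wpmul2l.
    by rewrite lee_fin prior_w_ge0.
  by rewrite -PE//; exact: h2.
apply: eq_integral => y _; rewrite -EFinM qN /wlr expRD expRN/=; congr EFin; ring.
Qed.

Lemma mean_sum_const (e : R) : \sum_(i < n) e = n%:R * e.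
Proof. by rewrite sumr_const card_ord mulr_natl. Qed.

(* [v = exp (l (|y - m0|^2 / s0^2 - n (1 + q / 2)))] with [l = q / 16]. *)
Lemma trunc_mass_large_var (q : R) : 0 < q -> q <= 1 / 4 ->
  (tmass [set t | (s0 ^+ 2 * (1 + q) <= (t.2 : R))%R] <=
   (expR (- (n%:R * q ^+ 2 / 64)) + delta^-1 * expR (- (n%:R * q ^+ 2 / 64)))%:E)%E.
Proof.
move=> q0 q1; set A := [set t | _].
have mA : measurable A.
  rewrite -[A]setTI; apply: measurable_fun_le => //.
have s02 : 0 < s0 ^+ 2 by rewrite exprn_gt0.
pose l := q / 16.
rewrite -[X in delta^-1 * X]mulr1.
apply: (trunc_mass_exp_le A (l / s0 ^+ 2) (fun=> 0) (fun=> - (l * (1 + q / 2)))) => //.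
- have wE : 1 - 2 * (l / s0 ^+ 2) * s0 ^+ 2 = 1 - q / 8.
    by rewrite /l; field; rewrite gt_eqF.
  apply: le_trans (expect_qform_le m0 s0 _ _ _ (q / 8 / 2 + (q / 8) ^+ 2) s00 _ _) _.
  + by rewrite wE; lra.
  + by rewrite wE; apply: one_minus_expR; lra.
  rewrite lee_fin ler_expR mean_sum_const wE expr0n/= !mul0r add0r.
  have -> : - (n%:R * q ^+ 2 / 64) = n%:R * (- (q ^+ 2 / 64)) by ring.
  by rewrite ler_wpM2l// /l; nra.
- move=> t At t2.
  pose v : R := (t.2 : R) / s0 ^+ 2.
  have hv : 1 + q <= v by rewrite ler_pdivlMr// mulrC.
  have wE : 1 - 2 * (- (l / s0 ^+ 2)) * (t.2 : R) = 1 + q / 8 * v.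
    by rewrite /l /v; field; rewrite gt_eqF.
  (* The least value of [q / 8 * v] over [v >= 1 + q]: the normalising factor decreases in [v], so
     one estimate serves all larger variances. *)
  pose x := q / 8 * (1 + q).
  have x0 : 0 <= x by rewrite mulr_ge0//; lra.
  have xv : x <= q / 8 * v by rewrite /x ler_pM2l//; lra.
  have w0 : 0 < 1 + q / 8 * v by lra.
  apply: le_trans (expect_qform_llr_le m0 s0 t.1 t.2 _ _ _ ((- x + x ^+ 2) / 2) s00 t2 _ _) _.
  + by rewrite wE.
  + rewrite wE; apply: (le_trans (one_plus_expR _ x0)).
    by rewrite ler_wpM2r ?expR_ge0// lerD2l.
  rewrite lee_fin ler_expR wE.
  have -> : - (n%:R * q ^+ 2 / 64) = \sum_(i < n) (- (q ^+ 2 / 64)).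
    by rewrite mean_sum_const; ring.
  apply: ler_sum => i _; rewrite oppr0 expr0n/= mulr0 !mul0r !addr0 opprK.
  set d2 := (_ - _) ^+ 2.
  have d20 : 0 <= d2 by rewrite sqr_ge0.
  (* A displaced mean helps this test, hence no condition on [t.1]. *)
  have hd : 2 * - (l / s0 ^+ 2) * d2 / (2 * (1 + q / 8 * v)) <= 0.
    rewrite mulr_le0_ge0 ?invr_ge0//; last by lra.
    rewrite mulr_le0_ge0// mulr_ge0_le0// oppr_le0 divr_ge0// /l; lra.
  suff : l * (1 + q / 2) + (- x + x ^+ 2) / 2 <= - (q ^+ 2 / 64) by lra.
  rewrite /x /l.
  have -> : q / 16 * (1 + q / 2) + (- (q / 8 * (1 + q)) + (q / 8 * (1 + q)) ^+ 2) / 2 =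
    - (q ^+ 2 / 32) + q ^+ 2 * ((1 + q) ^+ 2 / 128) by field.
  have hq : (1 + q) ^+ 2 / 128 <= 1 / 64 by nra.
  have := ler_wpM2l (sqr_ge0 q) hq; lra.
exact: prior_mass_le1.
Qed.

(* [v = exp (- l (|y - m0|^2 / s0^2 - n (1 - q / 4)))] with [l = q / 32]. *)
Lemma trunc_mass_small_var (q : R) : 0 < q -> q <= 1 / 4 ->
  (tmass [set t | ((t.2 : R) <= s0 ^+ 2 * (1 - 3 / 4 * q))%R /\
      (sqdist t.1 m0 <= n%:R * s0 ^+ 2 * q ^+ 2 / 4)%R] <=
   (expR (- (n%:R * q ^+ 2 / 256)) + delta^-1 * expR (- (n%:R * q ^+ 2 / 256)))%:E)%E.
Proof.
move=> q0 q1; set A := [set t | _ /\ _].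
have mA : measurable A.
  rewrite (_ : A = (setT `&` [set t | ((t.2 : R) <= s0 ^+ 2 * (1 - 3 / 4 * q))%R])
     `&` (setT `&` [set t | (sqdist t.1 m0 <= n%:R * s0 ^+ 2 * q ^+ 2 / 4)%R]));
     last by rewrite !setTI.
  apply: measurableI; apply: measurable_fun_le => //.
  exact: (measurableT_comp (measurable_sqdist m0) measurable_fst).
have s02 : 0 < s0 ^+ 2 by rewrite exprn_gt0.
pose l := q / 32.
rewrite -[X in delta^-1 * X]mulr1.
apply: (trunc_mass_exp_le A (- (l / s0 ^+ 2)) (fun=> 0) (fun=> l * (1 - q / 4))) => //.
- have wE : 1 - 2 * - (l / s0 ^+ 2) * s0 ^+ 2 = 1 + q / 16.
    by rewrite /l; field; rewrite gt_eqF.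
  apply: le_trans (expect_qform_le m0 s0 _ _ _ ((- (q / 16) + (q / 16) ^+ 2) / 2) s00 _ _) _.
  + by rewrite wE; lra.
  + by rewrite wE; apply: one_plus_expR; lra.
  rewrite lee_fin ler_expR mean_sum_const wE expr0n/= !mul0r add0r.
  have -> : - (n%:R * q ^+ 2 / 256) = n%:R * (- (q ^+ 2 / 256)) by ring.
  by rewrite ler_wpM2l// /l; nra.
- move=> t [At1 At2] t2.
  pose v : R := (t.2 : R) / s0 ^+ 2.
  have v0 : 0 < v by rewrite divr_gt0.
  have hv : v <= 1 - 3 / 4 * q by rewrite ler_pdivrMr// mulrC.
  have wE : 1 - 2 * (- - (l / s0 ^+ 2)) * (t.2 : R) = 1 - q / 16 * v.
    by rewrite /l /v; field; rewrite gt_eqF.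
  pose x := q / 16 * (1 - 3 / 4 * q).
  have x0 : 0 <= x by rewrite mulr_ge0//; lra.
  have xv : q / 16 * v <= x by rewrite /x ler_pM2l//; lra.
  have x1 : x <= 1 / 2 by rewrite /x; nra.
  have w0 : 1 / 2 <= 1 - q / 16 * v by lra.
  apply: le_trans (expect_qform_llr_le m0 s0 t.1 t.2 _ _ _ (x / 2 + x ^+ 2) s00 t2 _ _) _.
  + by rewrite wE; lra.
  + rewrite wE; apply: (le_trans (one_minus_expR _ x0 x1)).
    by rewrite ler_wpM2r ?expR_ge0// lerD2l lerN2.
  rewrite lee_fin ler_expR wE.
  apply: (@le_trans _ _ (\sum_(i < n) (2 * l / s0 ^+ 2 * (tnth t.1 i - tnth m0 i) ^+ 2
     + (- (l * (1 - q / 4)) + (x / 2 + x ^+ 2))))).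
    apply: ler_sum => i _; rewrite oppr0 expr0n/= mulr0 !mul0r !addr0 opprK -addrA.
    rewrite lerD2r; set d2 := (_ - _) ^+ 2.
    have d20 : 0 <= d2 by rewrite sqr_ge0.
    rewrite ler_pdivrMr; last by lra.
    rewrite -mulrA; have -> : 2 * l / s0 ^+ 2 * d2 * (2 * (1 - q / 16 * v)) =
      2 * (l / s0 ^+ 2 * d2) * (2 * (1 - q / 16 * v)) by ring.
    have : 0 <= l / s0 ^+ 2 * d2 by rewrite mulr_ge0// divr_ge0// /l; lra.
    move: (l / s0 ^+ 2 * d2) => z z0; nra.
  rewrite big_split/= -mulr_sumr mean_sum_const -/(sqdist _ _).
  (* Here displacement works against the test; the second condition of the set limits its cost to n
     q^3 / 64, which the gain of order n q^2 absorbs for [q <= 1 / 4]. *)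
  have hd : 2 * l / s0 ^+ 2 * sqdist t.1 m0 <= n%:R * (l * q ^+ 2 / 2).
    apply: (@le_trans _ _ (2 * l / s0 ^+ 2 * (n%:R * s0 ^+ 2 * q ^+ 2 / 4))).
      by rewrite ler_wpM2l// divr_ge0 ?sqr_ge0// /l; lra.
    by rewrite le_eqVlt; apply/orP; left; apply/eqP; field; rewrite gt_eqF.
  apply: (le_trans (lerD hd (lexx _))); rewrite -mulrDr.
  have -> : - (n%:R * q ^+ 2 / 256) = n%:R * (- (q ^+ 2 / 256)) by ring.
  rewrite ler_wpM2l// /x /l.
  have -> : q / 32 * q ^+ 2 / 2 + (- (q / 32 * (1 - q / 4)) +
     (q / 16 * (1 - 3 / 4 * q) / 2 + (q / 16 * (1 - 3 / 4 * q)) ^+ 2)) =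
    q ^+ 2 * (q / 64 - 1 / 64 + (1 - 3 / 4 * q) ^+ 2 / 256) by field.
  have hq : q / 64 - 1 / 64 + (1 - 3 / 4 * q) ^+ 2 / 256 <= - (1 / 256) by nra.
  have := ler_wpM2l (sqr_ge0 q) hq; lra.
exact: prior_mass_le1.
Qed.

(* [v = exp ((<y - m0, z - m0> - |z - m0|^2 / 4) / (16 s0^2))]; polarisation gives
   [<mu - m0, z - m0> >= |z - m0|^2 / 2] on the set considered. *)
Lemma trunc_mass_far_mean (z : n.-tuple R) (rho : R) :
  (tmass [set t | ((t.2 : R) <= 4 * s0 ^+ 2)%R /\
      ((sqdist t.1 z <= rho)%R /\ (rho <= sqdist t.1 m0)%R)] <=
   (expR (- (sqdist z m0 / s0 ^+ 2 / 128)) +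
    delta^-1 * expR (- (sqdist z m0 / s0 ^+ 2 / 128)))%:E)%E.
Proof.
set A := [set t | _ /\ _].
have mA : measurable A.
  rewrite (_ : A = (setT `&` [set t | ((t.2 : R) <= 4 * s0 ^+ 2)%R])
     `&` ((setT `&` [set t | (sqdist t.1 z <= rho)%R]) `&`
          (setT `&` [set t | (rho <= sqdist t.1 m0)%R])));
     last by rewrite !setTI.
  apply: measurableI; last apply: measurableI; apply: measurable_fun_le => //.
    exact: (measurableT_comp (measurable_sqdist z) measurable_fst).
  exact: (measurableT_comp (measurable_sqdist m0) measurable_fst).
have s02 : 0 < s0 ^+ 2 by rewrite exprn_gt0.
pose h i : R := tnth z i - tnth m0 i.
have hE (k : R) : \sum_(i < n) (k * h i ^+ 2) = k * sqdist z m0 by rewrite -mulr_sumr.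
rewrite -[X in delta^-1 * X]mulr1.
apply: (trunc_mass_exp_le A 0 (fun i => h i / (16 * s0 ^+ 2))
  (fun i => - (h i ^+ 2 / (64 * s0 ^+ 2)))) => //.
- apply: le_trans (expect_qform_le m0 s0 _ _ _ 0 s00 _ _) _.
  + by rewrite mulr0 mul0r subr0.
  + by rewrite !mulr0 mul0r subr0 expR0 mulr1.
  rewrite lee_fin ler_expR.
  rewrite (eq_bigr (fun i => - (7 / (512 * s0 ^+ 2)) * h i ^+ 2)); last first.
    by move=> i _; field; rewrite gt_eqF.
  rewrite hE -subr_ge0.
  have -> : - (sqdist z m0 / s0 ^+ 2 / 128) - - (7 / (512 * s0 ^+ 2)) * sqdist z m0 =
    3 / 512 * (sqdist z m0 / s0 ^+ 2) by field; rewrite gt_eqF.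
  apply: mulr_ge0; first by apply: divr_ge0; exact: ler0n.
  apply: divr_ge0; last exact: sqr_ge0.
  by apply: sumr_ge0 => i _; exact: sqr_ge0.
- move=> t [At1 [At2 At3]] t2.
  apply: le_trans (expect_qform_llr_le m0 s0 t.1 t.2 _ _ _ 0 s00 t2 _ _) _.
  + by rewrite oppr0 mulr0 mul0r subr0.
  + by rewrite oppr0 !mulr0 mul0r subr0 expR0 mulr1.
  rewrite lee_fin ler_expR.
  pose d i : R := tnth t.1 i - tnth m0 i.
  pose e i : R := tnth t.1 i - tnth z i.
  apply: (@le_trans _ _ (\sum_(i < n) (1 / (32 * s0 ^+ 2) *
    (e i ^+ 2 - d i ^+ 2 - h i ^+ 2 / 4)))).
    apply: ler_sum => i _; rewrite -subr_ge0.
    (* With e = d - h, the cross term is 2 d h = d^2 + h^2 - e^2. What remains is a nonnegative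
       multiple of [4 * s0 ^+ 2 - t.2], the place where the bound on the variance enters. *)
    rewrite [X in 0 <= X](_ : _ = (h i ^+ 2 / (512 * (s0 ^+ 2) ^+ 2)) *
       (4 * s0 ^+ 2 - (t.2 : R))); last first.
      by rewrite /h /d /e; field; rewrite gt_eqF.
    apply: mulr_ge0; last by rewrite subr_ge0.
    apply: divr_ge0; first exact: sqr_ge0.
    by apply: mulr_ge0; [exact: ler0n|exact: sqr_ge0].
  rewrite -mulr_sumr !sumrB -/(sqdist t.1 z) -/(sqdist t.1 m0).
  have -> : \sum_(i < n) h i ^+ 2 / 4 = sqdist z m0 / 4 by rewrite -mulr_suml.
  have -> : - (sqdist z m0 / s0 ^+ 2 / 128) =
    1 / (32 * s0 ^+ 2) * (- (sqdist z m0 / 4)) by field; rewrite gt_eqF.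
  rewrite ler_wpM2l//; first by rewrite divr_ge0// mulr_ge0 ?sqr_ge0.
  lra.
exact: prior_mass_le1.
Qed.

(** The test is the constant [expR (- x)], spread as [- x / n] over the coordinates (hence [0 < n]);
    the small prior mass alone has to offset [delta^-1]. *)
Lemma trunc_mass_prior (U : set (n.-tuple R)) (x e : R) :
  measurable U -> (Pmu U <= (expR e)%:E)%E -> (0 < n)%N ->
  (tmass (U `*` setT) <= (expR (- x) + delta^-1 * expR (x + e))%:E)%E.
Proof.
move=> mU hU n0; rewrite (expRD x e).
have nn0 : (n%:R : R) != 0 by rewrite pnatr_eq0 -lt0n.
apply: (trunc_mass_exp_le _ 0 (fun=> 0) (fun=> - (x / n%:R))).
- exact: measurableX.
- apply: le_trans (expect_qform_le m0 s0 _ _ _ 0 s00 _ _) _.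
  + by rewrite mulr0 mul0r subr0.
  + by rewrite !mulr0 mul0r subr0 expR0 mulr1.
  rewrite lee_fin ler_expR mean_sum_const expr0n/= !mul0r add0r addr0.
  by rewrite mulrN mulrC divfK.
- move=> t _ t2.
  apply: le_trans (expect_qform_llr_le m0 s0 t.1 t.2 _ _ _ 0 s00 t2 _ _) _.
  + by rewrite oppr0 mulr0 mul0r subr0.
  + by rewrite oppr0 !mulr0 mul0r subr0 expR0 mulr1.
  rewrite lee_fin ler_expR (eq_bigr (fun=> x / n%:R)); last first.
    by move=> i _; rewrite !oppr0 !mulr0 expr0n/= !mul0r !add0r mul0r add0r addr0 opprK.
  by rewrite mean_sum_const mulrC divfK.
by rewrite prior_mu_mass.
Qed.

(** On the interval of radius [h] the Lipschitz bound leaves g >= 2 L h - L h = L h, and the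
    interval, of length 2 h, lies in the positive half-line since [h < s0 ^+ 2]. *)
Lemma prior_ball_mass (U : set (n.-tuple R)) (L h : R) : measurable U ->
  (forall s t, 0 < s -> 0 < t -> `|g s - g t| <= L * `|s - t|) -> 0 <= L ->
  0 < h -> h < s0 ^+ 2 -> 2 * L * h <= g (s0 ^+ 2) ->
  (Pmu U * (2 * L * h ^+ 2)%:E <=
    \int[prior]_t (\1_(U `*` [set s : TR | (`|(s : R) - s0 ^+ 2| <= h)%R]) t * w t)%:E)%E.
Proof.
move=> mU lip L0 h0 hs gs.
have SE : [set s : TR | (`|(s : R) - s0 ^+ 2| <= h)%R] = `[s0 ^+ 2 - h, s0 ^+ 2 + h]%classic.
  by apply/seteqP; split => s /=; rewrite in_itv/= ler_distl.
have sub : `[s0 ^+ 2 - h, s0 ^+ 2 + h]%classic `<=` (`]0, +oo[%classic : set R).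
  by move=> s /=; rewrite !in_itv/= => /andP[s1 _]; rewrite andbT; lra.
rewrite prior_rect//; last by rewrite SE; exact: measurable_itv.
rewrite SE setIidl//; apply: lee_wpmul2l => //.
apply: (@le_trans _ _ (\int[leb]_(s in `[(s0 ^+ 2 - h)%R, (s0 ^+ 2 + h)%R]) (L * h)%:E)%E).
  rewrite integral_cst//= lebesgue_measure_itv/= lte_fin.
  rewrite (_ : (s0 ^+ 2 - h < s0 ^+ 2 + h) = true); last by lra.
  rewrite -EFinD -EFinM lee_fin le_eqVlt; apply/orP; left; apply/eqP; ring.
apply: ge0_le_integral => //.
- by move=> s _; rewrite lee_fin mulr_ge0// ltW.
- apply/measurable_EFinP; apply: measurable_funS mg => //.
move=> s hs'; have s_gt0 : 0 < s by have := sub _ hs'; rewrite /= in_itv/= andbT.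
move: hs'; rewrite /= in_itv/= -ler_distl => hd.
have := lip (s0 ^+ 2) s; rewrite exprn_gt0// => /(_ isT s_gt0).
rewrite distrC in hd; move=> hl; rewrite lee_fin.
have h2 := le_trans hl (ler_wpM2l L0 hd).
have := le_trans (ler_norm _) h2; lra.
Qed.

End regions.

(** * The bound at a fixed sample size *)

Section fixed_sample_size.
Context {R : realType} {n : nat}.
Local Notation TR := (measurableTypeR R).

(** The infimum is approached by a cover with fewer than [D + 1] centres, at most [2 * D] of them
    since [1 <= D]. *)
Lemma covering_number_witness (r D : R) (E : set (n.-tuple R)) :
  0 <= r -> 1 <= D -> (covering_number r E <= D%:E)%E ->
  exists c : seq (n.-tuple R), (size c)%:R <= 2 * D /\
    forall x, E x -> exists2 z, z \in c & sqdist x z <= r ^+ 2.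
Proof.
move=> r0 D1 hD.
have : (covering_number r E < (D + 1)%:E)%E.
  by apply: (le_lt_trans hD); rewrite lte_fin ltrDl.
move=> /ereal_inf_lt[_ [c Ec <-]]; rewrite lte_fin => cD.
exists c; split; first by lra.
move=> x /Ec[z zc hz]; exists z => //.
rewrite -[leLHS]sqr_sqrtr; last by apply: sumr_ge0 => i _; exact: sqr_ge0.
by rewrite ler_pXn2r// nnegrE.
Qed.

Lemma sqdist_le2 (x y z : n.-tuple R) :
  sqdist x y <= 2 * sqdist z y + 2 * sqdist x z.
Proof.
rewrite /sqdist !mulr_sumr -big_split/=; apply: ler_sum => i _; rewrite -subr_ge0.
rewrite (_ : _ - _ = (tnth x i - tnth z i - (tnth z i - tnth y i)) ^+ 2) ?sqr_ge0//.
by ring.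
Qed.

Lemma sqdist_ge0 (x y : n.-tuple R) : 0 <= sqdist x y.
Proof. by apply: sumr_ge0 => i _; exact: sqr_ge0. Qed.

Variables (m0 : n.-tuple R) (s0 eps M : R).
Hypotheses (n0 : (0 < n)%N) (s00 : 0 < s0) (eps0 : 0 < eps) (M4 : 4 <= M).
Local Notation q := (M * eps / s0).
Hypothesis q4 : q <= 1 / 4.
Local Notation alt := (std_alt [set p : n.-tuple R * R | M * eps <= dmet p.1 p.2 m0 s0]).

Let s02 : 0 < s0 ^+ 2. Proof. by rewrite exprn_gt0. Qed.
Let nn0 : 0 < n%:R :> R. Proof. by rewrite ltr0n. Qed.
Let M0 : 0 < M. Proof. exact: lt_le_trans M4. Qed.
Let q0 : 0 < q. Proof. by rewrite divr_gt0// mulr_gt0. Qed.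
Let Meps : M * eps = q * s0. Proof. by rewrite divfK// gt_eqF. Qed.

Lemma measurable_alt : measurable (alt : set (n.-tuple R * TR)).
Proof.
have ms : measurable_fun setT (fun x : R => Num.sqrt x).
  by apply: continuous_measurable_fun; exact: sqrt_continuous.
rewrite -[std_alt _]setTI.
apply: (@measurable_fun_le _ _ _ setT (fun=> M * eps)
  (fun t : n.-tuple R * TR => dmet t.1 (Num.sqrt (t.2 : R)) m0 s0)) => //.
apply: (measurableT_comp ms); apply: measurable_funD.
  apply: measurable_funM => //.
  exact: (measurableT_comp (measurable_sqdist m0) measurable_fst).
apply: measurable_funX; apply: measurable_funB => //.
exact: (measurableT_comp ms (measurable_fun_TR _ _ _ measurable_snd)).
Qed.

(** Outside the three cases the mean contributes at most q^2 s0^2 / 4 to the squared distance, and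
    |sigma - s0| is at most (3/4) q s0. The total fits because 1/4 + 9/16 < 1. *)
Lemma alt_cases (t : n.-tuple R * TR) : alt t ->
  [\/ s0 ^+ 2 * (1 + q) <= (t.2 : R),
      (t.2 : R) <= s0 ^+ 2 * (1 - 3 / 4 * q) /\
        sqdist t.1 m0 <= n%:R * s0 ^+ 2 * q ^+ 2 / 4
    | (t.2 : R) <= 4 * s0 ^+ 2 /\ n%:R * s0 ^+ 2 * q ^+ 2 / 4 < sqdist t.1 m0].
Proof.
case: t => mu s; rewrite /std_alt/= /dmet; set D := sqdist mu m0 => hd.
have q0' := q0; have q4' := q4; have s00' := s00.
have [s1|s1] := leP (s0 ^+ 2 * (1 + q)) s; first by apply: Or31.
have [D1|D1] := leP D (n%:R * s0 ^+ 2 * q ^+ 2 / 4); last first.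
  apply: Or33; split => //; apply: (le_trans (ltW s1)).
  by rewrite mulrC ler_pM2r//; lra.
have [s2|s2] := leP s (s0 ^+ 2 * (1 - 3 / 4 * q)); first by apply: Or32.
exfalso.
have s_gt0 : 0 < s.
  apply: lt_trans s2; rewrite mulr_gt0//; lra.
move: hd; rewrite Meps -[leLHS]ger0_norm; last by rewrite mulr_ge0// ltW.
rewrite -sqrtr_sqr ler_sqrt; last first.
  by rewrite addr_ge0 ?sqr_ge0// divr_ge0 ?ler0n// sqdist_ge0.
have Dn : D / n%:R <= s0 ^+ 2 * q ^+ 2 / 4.
  by rewrite ler_pdivrMr//; apply: (le_trans D1); lra.
set sg := Num.sqrt s.
have sg0 : 0 < sg by rewrite sqrtr_gt0.
have sgE : sg ^+ 2 = s by rewrite sqr_sqrtr// ltW.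
rewrite -sgE in s1 s2; clearbody sg D.
move: q q0' q4' Dn s1 s2 => k k0 k4 Dn s1 s2.
have ks : 0 < k * s0 by rewrite mulr_gt0.
have s3 : sg - s0 <= 3 / 4 * (k * s0).
  have : (sg - s0) * (sg + s0) < k * s0 * s0 by nra.
  move=> h; have [//|h2] := leP (sg - s0) (3 / 4 * (k * s0)).
  have h3 : 3 / 4 * (k * s0) * (2 * s0) <= (sg - s0) * (sg + s0).
    by apply: ler_pM; lra.
  have h4 : 0 < k * s0 * s0 by rewrite mulr_gt0.
  lra.
have s4 : s0 - sg <= 3 / 4 * (k * s0).
  have : (s0 - sg) * (sg + s0) < 3 / 4 * (k * s0) * s0 by nra.
  move=> h; have [//|h2] := leP (s0 - sg) (3 / 4 * (k * s0)).
  have h3 : 3 / 4 * (k * s0) * s0 <= (s0 - sg) * (sg + s0).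
    by apply: ler_pM; lra.
  lra.
have : (sg - s0) ^+ 2 <= (3 / 4 * (k * s0)) ^+ 2.
  rewrite -(@real_normK _ (sg - s0)) ?num_real// ler_pXn2r// ?nnegrE//.
    by rewrite ler_norml; apply/andP; split; lra.
  by rewrite mulr_ge0// ltW.
have : 0 < (k * s0) ^+ 2 by rewrite exprn_gt0.
rewrite exprMn in Dn *.
rewrite !exprMn; lra.
Qed.

(** A centre near a far mean is itself far: [sqdist_le2] gives |z - m0|^2 >= (M^2 / 8 - 1) n eps^2,
    at least M^2 n eps^2 / 16 since [4 <= M]. Only such centres are kept. *)
Lemma alt_subset (Mset : set (n.-tuple R)) (c : seq (n.-tuple R)) :
  (forall x, Mset x -> exists2 z, z \in c & sqdist x z <= n%:R * eps ^+ 2) ->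
  alt `<=` ((~` Mset) `*` setT) `|`
    ([set t : n.-tuple R * TR | s0 ^+ 2 * (1 + q) <= (t.2 : R)] `|`
    ([set t : n.-tuple R * TR | (t.2 : R) <= s0 ^+ 2 * (1 - 3 / 4 * q) /\
       sqdist t.1 m0 <= n%:R * s0 ^+ 2 * q ^+ 2 / 4] `|`
    \big[setU/set0]_(z <- [seq z <- c | n%:R * eps ^+ 2 * M ^+ 2 / 16 <= sqdist z m0])
      [set t : n.-tuple R * TR | (t.2 : R) <= 4 * s0 ^+ 2 /\
        (sqdist t.1 z <= n%:R * eps ^+ 2 /\ n%:R * eps ^+ 2 <= sqdist t.1 m0)])).
Proof.
move=> hc t /alt_cases[h|h|[h1 h2]]; first by right; left.
  by right; right; left.
have [Mt|Mt] := pselect (Mset t.1); last by left.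
right; right; right.
have [z zc hz] := hc _ Mt.
have qE : n%:R * s0 ^+ 2 * q ^+ 2 / 4 = n%:R * eps ^+ 2 * M ^+ 2 / 4.
  by field; rewrite gt_eqF.
rewrite qE in h2.
have ne : 0 < n%:R * eps ^+ 2 by rewrite mulr_gt0// exprn_gt0.
have M16 : 16 <= M ^+ 2 by have := M4; nra.
have h3 := sqdist_le2 t.1 m0 z.
rewrite -bigcup_seq; exists z.
  rewrite /= mem_filter zc andbT; nra.
split => //; split => //; nra.
Qed.

Variables (Pmu : probability (n.-tuple R) R) (g : R -> R) (L : R).
Variables (Mset : set (n.-tuple R)) (Cbar Dbar Ebar k : R).
Hypothesis g0 : forall s : R, 0 < s -> 0 <= g s.
Hypothesis mg : measurable_fun (`]0%R, +oo[%classic : set R) g.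
Hypothesis g1 : (\int[lebesgue_measure]_(s in `]0%R, +oo[%classic) (g s)%:E = 1)%E.
Hypothesis lip : forall s t : R, 0 < s -> 0 < t -> `|g s - g t| <= L * `|s - t|.
Hypotheses (L0 : 0 < L) (gs : 2 * L * s0 * eps <= g (s0 ^+ 2)).
Hypothesis e4 : eps / s0 <= 1 / 4.
Local Notation X := (n%:R * eps ^+ 2 / s0 ^+ 2).
Local Notation K := (Cbar + k + 4).
Hypothesis hk : expR (- (k * X)) <= 2 * L * (s0 * eps) ^+ 2.
Hypothesis hC : ((expR (- (Cbar * X)))%:E <=
  Pmu [set mu | (sqdist mu m0 <= n%:R * eps ^+ 2)%R])%E.
Hypotheses (D0 : 0 < Dbar) (K0 : 0 <= K).
Hypothesis hD : (covering_number (Num.sqrt n%:R * eps) Mset <= (expR (Dbar * X))%:E)%E.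
Hypothesis mM : measurable Mset.
Hypothesis hE : (Pmu (~` Mset) <= (expR (- (Ebar * X)))%:E)%E.
Hypotheses (EK : K + 2 <= Ebar) (MK : 2048 * (K + Dbar + 1) <= M ^+ 2).

Let X0 : 0 < X. Proof. by rewrite divr_gt0// mulr_gt0// exprn_gt0. Qed.

(** The 11 is 1 for the denominator, 2 each for the sieve complement and the two variance sets, and
    4 for the union over centres. The 2048 in [MK] is 16 (distance of kept centres) times 128
    (exponent of the linear test). *)
Lemma gauss_expect_posterior_bound :
  (gauss_expect m0 s0 (fun y =>
     (posterior Pmu g [set p | M * eps <= dmet p.1 p.2 m0 s0] y)%:E) <=
   (11 * expR (- X))%:E)%E.
Proof.
have [P PE] := gauss_expectE n m0 s0.
have x0 := X0.
pose h := s0 * eps.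
have h0 : 0 < h by rewrite mulr_gt0.
have hs : h <= s0 ^+ 2 / 4.
  by move: e4; rewrite ler_pdivrMr// /h expr2 -mulrA ler_pM2l//; lra.
pose U : set (n.-tuple R) := [set mu | sqdist mu m0 <= n%:R * eps ^+ 2].
have mU : measurable U.
  rewrite -[U]setTI; apply: measurable_fun_le => //.
  exact: measurable_sqdist.
pose S : set TR := [set s : TR | `|(s : R) - s0 ^+ 2| <= h].
have mS : measurable S.
  rewrite (_ : S = `[s0 ^+ 2 - h, s0 ^+ 2 + h]%classic).
    exact: measurable_itv.
  by apply/seteqP; split => s; rewrite /S/= in_itv/= ler_distl.
have mUS : measurable (U `*` S) by exact: measurableX.
set I := (\int[prior_meas Pmu]_t (\1_(U `*` S) t * prior_w g t)%:E)%E.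
have I1 : (I <= 1)%E by exact: prior_mass_le1.
have Ilow : ((expR (- (Cbar + k) * X))%:E <= I)%E.
  have gs' : 2 * L * h <= g (s0 ^+ 2) by rewrite /h mulrA.
  have hlt : h < s0 ^+ 2 by have := s02; lra.
  have := prior_ball_mass Pmu g g0 mg s0 s00 U L h mU lip (ltW L0) h0 hlt gs'.
  apply: le_trans.
  rewrite (_ : - (Cbar + k) * X = - (Cbar * X) + - (k * X)); last by ring.
  rewrite expRD EFinM; apply: lee_pmul => //; rewrite ?lee_fin ?expR_ge0//.
pose pB := fine I.
have IE : I = pB%:E.
  rewrite /pB fineK// ge0_fin_numE; first by apply: le_lt_trans I1 _; rewrite ltry.
  by apply: le_trans Ilow; rewrite lee_fin expR_ge0.
have pBlow : expR (- (Cbar + k) * X) <= pB by rewrite -lee_fin -IE.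
have pB0 : 0 < pB by apply: lt_le_trans pBlow; exact: expR_gt0.
(* The reciprocal ratio costs 3 X on the ball, namely 2 X from the mean and X from the variance; the
   fourth X leaves the error e^(-X). *)
pose delta := pB * expR (- (4 * X)).
have d0 : 0 < delta by rewrite mulr_gt0// expR_gt0.
have dinv : delta^-1 <= expR (K * X).
  rewrite /delta invfM -expRN opprK.
  rewrite (_ : K * X = (Cbar + k) * X + 4 * X); last by ring.
  rewrite expRD ler_pM2r ?expR_gt0//.
  rewrite -[leRHS]invrK -expRN lef_pV2 ?posrE ?expR_gt0//.
  by rewrite -mulNr.
have mA := measurable_alt.
have := gauss_expect_posterior_le Pmu g g0 mg m0 s0 s00 _ (U `*` S) (expR (3 * X)) pB delta P
  PE mA mUS pB0 (expR_ge0 _) d0 IE.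
have hB (t : n.-tuple R * TR) : (U `*` S) t ->
  (gauss_expect m0 s0 (fun y => (expR (- llr m0 s0 t.1 t.2 y))%:E) <= (expR (3 * X))%:E)%E.
  move=> [/= tU tS].
  pose u : R := ((t.2 : R) - s0 ^+ 2) / s0 ^+ 2.
  have tE : (t.2 : R) = s0 ^+ 2 * (1 + u) by rewrite /u; field; rewrite gt_eqF.
  have uh : `|u| <= eps / s0.
    rewrite /u normrM normfV (ger0_norm (ltW s02)) ler_pdivrMr//.
    rewrite (_ : eps / s0 * s0 ^+ 2 = h)//.
    by rewrite /h; field; rewrite gt_eqF.
  rewrite [X in llr _ _ _ X](_ : _ = s0 ^+ 2 * (1 + u)); last exact: tE.
  apply: le_trans (expect_llr_inv_le _ _ _ _ s00 (le_trans uh e4)) _.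
  rewrite lee_fin ler_expR big_split/= mean_sum_const -mulr_suml -mulr_sumr -/(sqdist _ _).
  have u2 : u ^+ 2 <= eps ^+ 2 / s0 ^+ 2.
    rewrite -exprVn -exprMn -(@real_normK _ u) ?num_real// ler_pXn2r// ?nnegrE//.
    by rewrite divr_ge0// ltW.
  have h1 : 2 * sqdist t.1 m0 / s0 ^+ 2 <= 2 * X.
    by rewrite -mulrA ler_pM2l// ler_pM2r ?invr_gt0.
  have h2 : n%:R * u ^+ 2 <= X by rewrite -mulrA ler_pM2l.
  lra.
move=> /(_ hB) /le_trans; apply.
have nX : n%:R * q ^+ 2 = M ^+ 2 * X by field; rewrite gt_eqF.
have D1 : 1 <= expR (Dbar * X) by rewrite -[leLHS]expR0 ler_expR; apply: mulr_ge0; exact: ltW.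
have rr : 0 <= Num.sqrt n%:R * eps :> R by rewrite mulr_ge0 ?sqrtr_ge0// ltW.
have [c [cs cM]] := covering_number_witness _ _ _ rr D1 hD.
rewrite exprMn sqr_sqrtr ?ler0n// in cM.
pose c' := [seq z <- c | n%:R * eps ^+ 2 * M ^+ 2 / 16 <= sqdist z m0].
have sub := alt_subset Mset c cM.
pose A0 : set (n.-tuple R * TR) := (~` Mset) `*` setT.
pose A1 : set (n.-tuple R * TR) := [set t | s0 ^+ 2 * (1 + q) <= (t.2 : R)].
pose A2 : set (n.-tuple R * TR) := [set t | (t.2 : R) <= s0 ^+ 2 * (1 - 3 / 4 * q) /\
       sqdist t.1 m0 <= n%:R * s0 ^+ 2 * q ^+ 2 / 4].
pose A3 z : set (n.-tuple R * TR) := [set t | (t.2 : R) <= 4 * s0 ^+ 2 /\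
        (sqdist t.1 z <= n%:R * eps ^+ 2 /\ n%:R * eps ^+ 2 <= sqdist t.1 m0)].
have eX (a : R) : 1 <= a -> expR (- (a * X)) <= expR (- X).
  by move=> a1; rewrite ler_expR lerN2 -[leLHS]mul1r ler_pM2r.
have dX (a b : R) : K + b <= a -> delta^-1 * expR (- (a * X)) <= expR (- (b * X)).
  move=> ab; apply: (@le_trans _ _ (expR (K * X) * expR (- (a * X)))).
    by rewrite ler_wpM2r ?expR_ge0.
  by rewrite -expRD ler_expR; nra.
have MK' := MK; have EK' := EK; have K0' := K0; have D0' := D0.
have mA0 : measurable A0 by apply: measurableX => //; exact: measurableC.
have mA1 : measurable A1.
  by rewrite -[A1]setTI; apply: measurable_fun_le.
have mA2 : measurable A2.
  rewrite (_ : A2 = (setT `&` [set t | ((t.2 : R) <= s0 ^+ 2 * (1 - 3 / 4 * q))%R])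
     `&` (setT `&` [set t | (sqdist t.1 m0 <= n%:R * s0 ^+ 2 * q ^+ 2 / 4)%R]));
     last by rewrite !setTI.
  apply: measurableI; apply: measurable_fun_le => //.
  exact: (measurableT_comp (measurable_sqdist m0) measurable_fst).
have mA3 z : measurable (A3 z).
  rewrite (_ : A3 z = (setT `&` [set t | ((t.2 : R) <= 4 * s0 ^+ 2)%R])
     `&` ((setT `&` [set t | (sqdist t.1 z <= n%:R * eps ^+ 2)%R]) `&`
          (setT `&` [set t | (n%:R * eps ^+ 2 <= sqdist t.1 m0)%R])));
     last by rewrite !setTI.
  apply: measurableI; last apply: measurableI; apply: measurable_fun_le => //.
    exact: (measurableT_comp (measurable_sqdist z) measurable_fst).
  exact: (measurableT_comp (measurable_sqdist m0) measurable_fst).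
have mA4 : measurable (\big[setU/set0]_(z <- c') A3 z).
  by apply: bigsetU_measurable => z _; exact: mA3.
set tm := trunc_mass _ _ _ _.
have wg := wlr_ge0 g g0 m0 s0; have wm := measurable_wlr g mg m0 s0.
have tmU := trunc_massU P (prior_meas Pmu) (wlr g m0 s0) wg wm delta d0.
have tm0 : (tm A0 <= (2 * expR (- X))%:E)%E.
  apply: le_trans (trunc_mass_prior Pmu g g0 mg g1 m0 s0 s00 P PE delta d0
    (~` Mset) X (- (Ebar * X)) (measurableC mM) hE n0) _.
  have -> : X + - (Ebar * X) = - ((Ebar - 1) * X) by ring.
  have := dX (Ebar - 1) 1; rewrite mul1r lee_fin => /(_ ltac:(lra)); lra.
have tm1 : (tm A1 <= (2 * expR (- X))%:E)%E.
  apply: le_trans (trunc_mass_large_var Pmu g g0 mg g1 m0 s0 s00 P PE delta d0 q q0 q4) _.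
  rewrite nX (_ : M ^+ 2 * X / 64 = M ^+ 2 / 64 * X); last by ring.
  have := dX (M ^+ 2 / 64) 1; have := eX (M ^+ 2 / 64).
  rewrite mul1r lee_fin => /(_ ltac:(lra)) ? /(_ ltac:(lra)); lra.
have tm2 : (tm A2 <= (2 * expR (- X))%:E)%E.
  apply: le_trans (trunc_mass_small_var Pmu g g0 mg g1 m0 s0 s00 P PE delta d0 q q0 q4) _.
  rewrite nX (_ : M ^+ 2 * X / 256 = M ^+ 2 / 256 * X); last by ring.
  have := dX (M ^+ 2 / 256) 1; have := eX (M ^+ 2 / 256).
  rewrite mul1r lee_fin => /(_ ltac:(lra)) ? /(_ ltac:(lra)); lra.
have tm3 : (tm (\big[setU/set0]_(z <- c') A3 z) <= (4 * expR (- X))%:E)%E.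
  apply: (@le_trans _ _ ((size c')%:R * (2 * expR (- ((Dbar + 1) * X))))%:E).
    apply: (trunc_mass_bigcup P (prior_meas Pmu) _ wg wm delta d0 _ c' A3 _ mA3) => z.
    rewrite mem_filter => /andP[zM _].
    apply: le_trans (trunc_mass_far_mean Pmu g g0 mg g1 m0 s0 s00 P PE delta d0 z _) _.
    have hz : M ^+ 2 / 2048 * X <= sqdist z m0 / s0 ^+ 2 / 128.
      rewrite (_ : M ^+ 2 / 2048 * X = n%:R * eps ^+ 2 * M ^+ 2 / 16 / s0 ^+ 2 / 128).
        by rewrite ler_pM2r// ler_pM2r// invr_gt0.
      by field; rewrite gt_eqF.
    have hz2 : expR (- (sqdist z m0 / s0 ^+ 2 / 128)) <= expR (- (M ^+ 2 / 2048 * X)).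
      by rewrite ler_expR lerN2.
    have hz3 : delta^-1 * expR (- (sqdist z m0 / s0 ^+ 2 / 128)) <=
       delta^-1 * expR (- (M ^+ 2 / 2048 * X)).
      by rewrite ler_wpM2l// invr_ge0 ltW.
    have hz4 : expR (- (M ^+ 2 / 2048 * X)) <= expR (- ((Dbar + 1) * X)).
      by rewrite ler_expR lerN2 ler_pM2r//; lra.
    have := dX (M ^+ 2 / 2048) (Dbar + 1); rewrite lee_fin => /(_ ltac:(lra)); lra.
  have c'c : (size c')%:R <= 2 * expR (Dbar * X).
    by apply: le_trans cs; rewrite ler_nat size_filter; exact: count_size.
  rewrite lee_fin.
  (* The entropy factor cancels against the [Dbar] reserved in each exponent. *)
  apply: (@le_trans _ _ (2 * expR (Dbar * X) * (2 * expR (- ((Dbar + 1) * X))))).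
    by rewrite ler_wpM2r// mulr_ge0// expR_ge0.
  rewrite (_ : - ((Dbar + 1) * X) = - (Dbar * X) + - X); last by ring.
  rewrite expRD (expRN (Dbar * X)) le_eqVlt; apply/orP; left; apply/eqP.
  by field; rewrite gt_eqF// expR_gt0.
rewrite (_ : delta * expR (3 * X) / pB = expR (- X)); last first.
  rewrite /delta (_ : - X = - (4 * X) + 3 * X) ?expRD; last by ring.
  by field; rewrite gt_eqF.
rewrite (_ : 11 * expR (- X) = expR (- X) + (2 * expR (- X) + (2 * expR (- X) +
  (2 * expR (- X) + 4 * expR (- X))))); last by ring.
rewrite EFinD; apply: leeD; first exact: lexx.
apply: (le_trans (le_trunc_mass _ _ _ wg _ d0 _ _ mA _ sub)).
  exact: measurableU mA0 (measurableU _ _ mA1 (measurableU _ _ mA2 mA4)).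
apply: (le_trans (tmU _ _ mA0 (measurableU _ _ mA1 (measurableU _ _ mA2 mA4)))).
rewrite EFinD; apply: leeD; first exact: tm0.
apply: (le_trans (tmU _ _ mA1 (measurableU _ _ mA2 mA4))).
rewrite EFinD; apply: leeD; first exact: tm1.
apply: (le_trans (tmU _ _ mA2 mA4)).
by rewrite EFinD; apply: leeD; [exact: tm2|exact: tm3].
Qed.

End fixed_sample_size.

(** * Consequences of the Lipschitz condition on the prior density *)

Section lipschitz_density.
Context {R : realType} (g : R -> R) (L : R).
Hypothesis lip : forall s t : R, 0 < s -> 0 < t -> `|g s - g t| <= L * `|s - t|.

Lemma lipschitz_measurable : measurable_fun (`]0%R, +oo[%classic : set R) g.
Proof.
apply: open_continuous_measurable_fun; first exact: interval_open.
move=> x; rewrite inE/= in_itv/= andbT => x0.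
apply/cvgrPdist_le => e e0.
have L1 : 0 < `|L| + 1 by rewrite ltr_wpDl.
near=> t.
have t0 : 0 < t by near: t; exact: lt_nbhsr.
apply: (le_trans (lip _ _ x0 t0)).
have d : `|x - t| <= e / (`|L| + 1).
  by near: t; apply: (@cvgr_dist_le _ _ _ _ _ id x) => //; rewrite divr_gt0.
apply: (@le_trans _ _ ((`|L| + 1) * `|x - t|)).
  by rewrite ler_wpM2r// (le_trans (ler_norm _))// lerDl.
by rewrite mulrC -ler_pdivlMr.
Unshelve. all: by end_near. Qed.

(** With [L <= 0] the density would be constant on a half-line of infinite length and could not
    integrate to 1. *)
Lemma lipschitz_density_gt0 :
  (\int[lebesgue_measure]_(s in `]0%R, +oo[%classic) (g s)%:E = 1)%E -> 0 < L.
Proof.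
move=> g1; rewrite ltNge; apply/negP => L0.
have gE s : 0 < s -> g s = g 1.
  move=> s0; apply/eqP; rewrite -subr_eq0 -normr_le0.
  by apply: (le_trans (lip _ _ s0 ltr01)); rewrite mulr_le0_ge0.
move: g1; rewrite (eq_integral (cst (g 1)%:E)); last first.
  by move=> s; rewrite inE/= in_itv/= andbT => /gE ->.
rewrite integral_cst//= lebesgue_measure_itv/= ltry.
rewrite addye//.
have [->|g10] := eqVneq (g 1) 0; first by rewrite mul0e => /eqP; rewrite eqe eq_sym oner_eq0.
by rewrite mulry; case: sgrP g10 => // _ _; rewrite ?mul1e ?mulN1e.
Qed.

End lipschitz_density.

(** * Choice of the constants and passage to the limit *)

Theorem theorem4 (R : realType) (B Cbar : R) (hB : 0 < B) (hC : 0 < Cbar) :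
  exists E0 : R, forall
    (mu0 : forall n : nat, n.-tuple R) (sig0 eps : nat -> R)
    (Pmu : forall n : nat, probability (n.-tuple R) R)
    (g : R -> R) (L : R)
    (Mset : forall n : nat, set (n.-tuple R)) (Dbar Ebar : R),
  (* true parameters *)
  (forall n, 0 < sig0 n) ->
  (forall n, (0 < n)%N -> (n%:R : R) `^ (- B) < sig0 n ^+ 2) ->
  (* prior of sigma^2: density g on (0,oo), L-Lipschitz, tail O(1/t) *)
  (forall s, 0 < s -> 0 <= g s) ->
  (\int[lebesgue_measure]_(s in `]0%R, +oo[%classic) (g s)%:E = 1)%E ->
  (forall s t, 0 < s -> 0 < t -> `|g s - g t| <= L * `|s - t|) ->
  (exists K T : R, 0 < T /\ forall t, T <= t ->
     (\int[lebesgue_measure]_(s in `]t, +oo[%classic) (g s)%:E <= (K / t)%:E)%E) ->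
  (* rate eps_n *)
  (forall n, 0 < eps n) ->
  (eps n / sig0 n) @[n --> \oo] --> 0 ->
  (forall n, (0 < n)%N -> ln (n%:R : R) <= n%:R * eps n ^+ 2 / sig0 n ^+ 2) ->
  (forall n, (0 < n)%N -> 2 * L * sig0 n * eps n <= g (sig0 n ^+ 2)) ->
  (* prior mass, entropy and remaining mass conditions *)
  0 < Dbar -> 0 < Ebar -> E0 < Ebar ->
  (forall n, (0 < n)%N ->
     ((expR (- Cbar * n%:R * eps n ^+ 2 / sig0 n ^+ 2))%:E <=
       Pmu n [set mu | (sqdist mu (mu0 n) <= n%:R * eps n ^+ 2)%R])%E) ->
  (forall n, (0 < n)%N ->
     (covering_number (Num.sqrt n%:R * eps n) (Mset n) <=
       (expR (Dbar * n%:R * eps n ^+ 2 / sig0 n ^+ 2))%:E)%E) ->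
  (forall n, (0 < n)%N -> measurable (Mset n)) ->
  (forall n, (0 < n)%N ->
     (Pmu n (~` Mset n) <= (expR (- Ebar * n%:R * eps n ^+ 2 / sig0 n ^+ 2))%:E)%E) ->
  exists M : R, 0 < M /\
    (gauss_expect (mu0 n) (sig0 n) (fun y =>
       (posterior (Pmu n) g
          [set p | M * eps n <= dmet p.1 p.2 (mu0 n) (sig0 n)] y)%:E))
    @[n --> \oo] --> (0 : \bar R).
Proof.
(* This is K + 2 for the [k] and [K] fixed below. *)
exists (Cbar + 2 * B + 8) => mu0 sig0 eps Pmu g L Mset Dbar Ebar sig00 sig0B g0 g1 lip _
  eps0 eta0 hln hgs D0 _ hE hprior hcov mMset hrem.
have L0 : 0 < L by exact: lipschitz_density_gt0 lip g1.
(* The prior mass of the variance interval is at least 2 L sig0^4 X / n. Here sig0^4 >= n^(-2B) and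
   X >= 1 eventually; [L] is chosen after [E0], so 2 L is bounded below by 1/n for large n. The
   product is at least n^(-(2B + 2)) >= e^(-k X). *)
have mg := lipschitz_measurable g L lip.
pose k := 2 * B + 2; pose K := Cbar + k + 4.
(* As [M >= 1], the requirement on M^2 follows from this bound on [M], and no square root is
   taken. *)
pose M := 2048 * (K + Dbar + 1).
have M1 : 2048 <= M by rewrite /M /K /k; lra.
have M0 : 0 < M by lra.
exists M; split=> //.
have Xe (a : R) n : a * n%:R * eps n ^+ 2 / sig0 n ^+ 2 =
   a * (n%:R * eps n ^+ 2 / sig0 n ^+ 2) by rewrite !mulrA.
have main : \forall n \near \oo,
    (0 <= gauss_expect (mu0 n) (sig0 n) (fun y =>
       (posterior (Pmu n) g
          [set p | M * eps n <= dmet p.1 p.2 (mu0 n) (sig0 n)] y)%:E) <=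
     (11 * n%:R^-1)%:E)%E.
  near=> n.
  have n0 : (0 < n)%N by near: n; exact: nbhs_infty_gt.
  have n0' : 0 < n%:R :> R by rewrite ltr0n.
  have s02 : 0 < sig0 n ^+ 2 by rewrite exprn_gt0.
  have e0 : 0 < eps n / sig0 n by rewrite divr_gt0.
  (* Gives [q <= 1 / 4], the range in which the variance tests work. *)
  have eM : eps n / sig0 n <= (4 * M)^-1.
    rewrite -[leLHS]gtr0_norm// -normrN -[- _]add0r; near: n.
    by apply: (@cvgr_dist_le _ _ _ _ _ _ 0 eta0); rewrite invr_gt0 mulr_gt0.
  have n1 : expR 1 <= n%:R :> R by near: n; exact: nbhs_infty_ger.
  have nL : (2 * L)^-1 <= n%:R :> R by near: n; exact: nbhs_infty_ger.
  have lnX := hln n n0; set X := _ / _ in lnX.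
  have ln1 : 1 <= ln (n%:R : R) by rewrite -[leLHS]expRK ler_ln ?posrE ?expR_gt0.
  have expln : expR (- ln (n%:R : R)) = n%:R^-1 by rewrite expRN lnK.
  have eXn : expR (- X) <= n%:R^-1 by rewrite -expln ler_expR lerN2.
  apply/andP; split.
    apply: gauss_expect_ge0 => y; rewrite lee_fin.
    have pn0 A : (0 <= post_num (Pmu n) g A y)%E.
      apply: integral_ge0 => mu _; apply: integral_ge0 => s.
      rewrite /= in_itv/= andbT => s_gt0; rewrite lee_fin; apply: mulr_ge0.
        by rewrite mulr_ge0// g0.
      by apply: ltW; rewrite lik_gt0 ?sqrtr_gt0.
    by rewrite /posterior divr_ge0// fine_ge0.
  apply: (@le_trans _ _ (11 * expR (- X))%:E); last by rewrite lee_fin ler_pM2l.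
  apply: (gauss_expect_posterior_bound (mu0 n) (sig0 n) (eps n) M n0 (sig00 n) (eps0 n)
    _ _ (Pmu n) g L (Mset n) Cbar Dbar Ebar k g0 mg g1 lip L0 (hgs n n0)) => //.
  - by lra.
  - rewrite -mulrA mulrC -ler_pdivlMr//; apply: (le_trans eM).
    by rewrite invfM mul1r.
  - apply: (le_trans eM); rewrite mul1r lef_pV2 ?posrE//; lra.
  - have sB : expR (- (B * ln n%:R)) < sig0 n ^+ 2.
      by have := sig0B n n0; rewrite /powR gt_eqF// mulNr.
    have X1 : 1 <= X by exact: le_trans lnX.
    have -> : 2 * L * (sig0 n * eps n) ^+ 2 = 2 * L * (sig0 n ^+ 2) ^+ 2 * X * n%:R^-1.
      by rewrite /X; field; rewrite !gt_eqF.
    have h1 : n%:R^-1 <= 2 * L.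
      by rewrite -[leRHS]invrK lef_pV2 ?posrE ?invr_gt0 ?mulr_gt0.
    have h2 : expR (- (B * ln n%:R)) ^+ 2 <= (sig0 n ^+ 2) ^+ 2.
      by rewrite ler_pXn2r// ?nnegrE ?expR_ge0 ?ltW.
    apply: (@le_trans _ _ (expR (- (k * ln n%:R)))).
      by rewrite ler_expR lerN2 ler_pM2l// /k; lra.
    have -> : expR (- (k * ln n%:R)) = n%:R^-1 * expR (- (B * ln n%:R)) ^+ 2 * 1 * n%:R^-1.
      rewrite mulr1 -expln -expRM_natl -!expRD; congr expR; rewrite /k; ring.
    rewrite ler_pM2r ?invr_gt0//; apply: ler_pM => //.
    by apply: ler_pM; rewrite ?h1 ?h2 ?exprn_ge0 ?expR_ge0 ?invr_ge0 ?(ltW n0').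
  - by rewrite -mulNr -Xe hprior.
  - by rewrite /K /k; lra.
  - by rewrite -Xe hcov.
  - exact: mMset.
  - by rewrite -mulNr -Xe hrem.
  - by rewrite /k; lra.
  - by rewrite -/K -/M expr2 ler_peMr// ltW//; lra.
apply: (squeeze_cvge main); first exact: cvg_cst.
have -> : (0 : \bar R) = (11 * 0)%:E by rewrite mulr0.
apply: cvg_EFin; first by near=> n.
apply: cvgM; first exact: cvg_cst.
apply/gtr0_cvgV0; last exact: cvgr_idn.
by near=> n; rewrite ltr0n; near: n; exact: nbhs_infty_gt.
Unshelve. all: by end_near. Qed.
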